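(* Fix $R>0$. There exist a constant $C<\infty$ depending only on $R$ and an absolute constant $\bar C>0$ such that the following holds. Let $n,d$ be positive integers with $1\le d\le n^{100}$, let $z\in\mathbb C$ with $|z|\le R$, and let $S_n^d=\sum_{\ell=1}^d P_n^\ell$ where $P_n^1,\dots,P_n^d$ are the permutation matrices ($P_n^\ell(i,j)=\mathbf 1(\pi_n^\ell(i)=j)$) of independent uniformly random permutations $\pi_n^1,\dots,\pi_n^d$ of $[n]$. Then $$\mathbb P\Big\{ s_n\Big(\tfrac{1}{\sqrt d}S_n^d-zI_n\Big)\le n^{-\bar C\log_{d\wedge n} n}\Big\}\le C\,\frac{\log^4 n}{\sqrt{d\wedge n}},$$ where $s_n(\cdot)$ denotes the smallest singular value and $d\wedge n=\min(d,n)$.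
   Formalization: The formal statement assumes n ≥ 2: for n = d = 1 the base of the logarithm is 1 and the right-hand side is 0, while z = 0 gives s_1 = 1 ≤ 1 with probability 1, so the claim fails there. *)

(* Defs.v *)
From HB Require Import structures.
From mathcomp Require Import all_boot all_order all_algebra all_fingroup.
From mathcomp Require Import complex.
From mathcomp Require Import boolp classical_sets reals exp.
Set Implicit Arguments. Unset Strict Implicit. Unset Printing Implicit Defensive.
Import Order.TTheory GRing.Theory Num.Theory.
Local Open Scope ring_scope.
Local Open Scope complex_scope.

Definition vnorm2 (R : rcfType) (n : nat) (v : 'cV[R[i]]_n) : R :=
  \sum_(k < n) ((complex.Re (v k ord0)) ^+ 2 + (complex.Im (v k ord0)) ^+ 2).

Definition vnorm (R : rcfType) (n : nat) (v : 'cV[R[i]]_n) : R :=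
  Num.sqrt (vnorm2 v).

Definition smin (R : realType) (n : nat) (M : 'M[R[i]]_n) : R :=
  inf [set vnorm (M *m x) | x in [set x : 'cV[R[i]]_n | vnorm x = 1]].

Definition perm_sum (R : rcfType) (n d : nat) (pi : {ffun 'I_d -> {perm 'I_n}})
  : 'M[R[i]]_n :=
  \matrix_(a < n, b < n) \sum_(l < d) ((pi l a == b)%:R : R[i]).

Definition shifted_matrix (R : rcfType) (n d : nat) (z : R[i])
  (pi : {ffun 'I_d -> {perm 'I_n}}) : 'M[R[i]]_n :=
  ((Num.sqrt (d%:R : R))^-1)%:C *: perm_sum R pi - z%:M.

(* Probability of an event under the uniform law of d independent uniform
   permutations of [n], i.e. the uniform law on {ffun 'I_d -> {perm 'I_n}}. *)
Definition uprob (n d : nat) (R : realType)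
  (E : {ffun 'I_d -> {perm 'I_n}} -> Prop) : R :=
  (#|[set pi : {ffun 'I_d -> {perm 'I_n}} | `[< E pi >]]|%:R)
  / (#|{: {ffun 'I_d -> {perm 'I_n}}}|%:R).

(* Main.v *)
(** Write [w = sqrt d * z] and [M = S - w I].  Choosing between two values
    [pi l a], [pi l b] by a fair coin is a measure preserving swap, and all the
    randomness used below comes from such swaps.

    Nearly null vectors are unstructured.  Let [x] have sup norm one, and suppose
    that at scale [rho'] all but [m] coordinates of [x] are close to a common
    value, while at a larger scale [rho] at least [m / q] are not.  Swapping the
    [d m / q] pairs made of an exceptional and a typical coordinate shows that a
    fixed such [x] is nearly null with probability at most
    [(3/4) ^ min (d m / q) (n / 10)], which beats the [exp (O (m log^2 n))] points
    of a net when [q] is about [d / log^2 n].  Hence the number of exceptional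
    coordinates is multiplied by [q] at each scale, and after [O (log_d n)] scales
    it exceeds [n / O (log^2 n)], whatever the common value.

    If the smallest singular value is tiny there are nearly null vectors [v] on
    the left and [u] on the right, both unstructured.  For a proportion
    [1 / O (log^2 n)] of the pairs of rows [i], [j] the entries [v i] and [v j]
    are far apart and [u (pi l i)], [u (pi l j)] are far apart for
    [d / O (log^2 n)] indices [l]; the latter holds for most pairs by a union
    bound over a net for [u] and over matchings of bad pairs.  For such a pair,
    swapping [pi l i] and [pi l j] for the various [l] preserves the constraints
    on [u] given by the other rows and by the sum of the two rows, and the
    existence of [v] forces the [i]-th entry of [M u] to be tiny, an event of
    probability [O (log n / sqrt d)] by the Littlewood-Offord inequality.
    Averaging over the pairs concludes. *)

Require Import Defs.
From HB Require Import structures.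
From mathcomp Require Import all_boot all_order all_algebra all_fingroup.
From mathcomp Require Import complex.
From mathcomp Require Import boolp classical_sets reals exp.
From mathcomp Require Import ring lra zify.
Set Implicit Arguments. Unset Strict Implicit. Unset Printing Implicit Defensive.
Import Order.TTheory GRing.Theory Num.Theory.
Local Open Scope ring_scope.
Local Open Scope complex_scope.

(** * Swaps and sequential exposure of the permutations *)

Local Notation perms n d := {ffun 'I_d -> {perm 'I_n}} (only parsing).

Section Exposure.
Variables (n d : nat).
Implicit Types (pi : perms n d) (l k : 'I_d) (a b c : 'I_n).

(** Permutations compose from left to right, so this exchanges the values of [pi l] at [a] and
    [b]. *)
Definition twist l a b pi : perms n d :=
  [ffun k => if k == l then (tperm a b * pi k)%g else pi k].

Lemma twistE l a b pi k i :
  twist l a b pi k i = pi k (if k == l then tperm a b i else i).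
Proof. by rewrite ffunE; case: eqP => // _; rewrite permM. Qed.

Lemma twistK l a b : involutive (twist l a b).
Proof.
move=> pi; apply/ffunP => k; rewrite !ffunE; case: eqP => // _.
by rewrite mulgA tperm2 mul1g.
Qed.

Lemma sum_twist (V : nmodType) (F : perms n d -> V) l a b :
  \sum_pi F (twist l a b pi) = \sum_pi F pi.
Proof. by rewrite [RHS](reindex_inj (inv_inj (twistK l a b))). Qed.

(* Conditionally on [pi l] restricted to [D], the value [pi l c] is uniform
   over the remaining points; the conditioning is replaced by invariance under
   exchanging [c] with any point outside [D]. *)
Lemma expose (R : realFieldType) (F : perms n d -> R)
    (B : perms n d -> {set 'I_n}) l c (D : {set 'I_n}) (beta : nat) :
    (forall pi, 0 <= F pi) ->
    (forall c' pi, c' \notin D -> F (twist l c c' pi) = F pi) ->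
    (forall c' pi, c' \notin D -> B (twist l c c' pi) = B pi) ->
    (forall pi, (#|B pi| <= beta)%N) ->
  (n - #|D|)%:R * \sum_pi F pi *+ (pi l c \in B pi)
    <= beta%:R * \sum_pi F pi.
Proof.
move=> F0 FD BD Bb.
have cD : #|~: D| = (n - #|D|)%N.
  by have := cardsC D; rewrite card_ord; lia.
have E c' : c' \in ~: D -> \sum_pi F pi *+ (pi l c \in B pi) =
    \sum_pi F pi *+ (pi l c' \in B pi).
  rewrite inE => c'D; rewrite -(sum_twist _ l c c').
  by apply: eq_bigr => pi _; rewrite FD // BD // twistE eqxx tpermL.
rewrite -cD mulr_natl -sumr_const (eq_bigr _ E) exchange_big /= mulr_sumr.
apply: ler_sum => pi _.
rewrite sumrMnr mulr_natl; apply: ler_wpMn2l => //.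
have -> : (\sum_(c' in ~: D) (pi l c' \in B pi) =
    #|[set c' in ~: D | pi l c' \in B pi]|)%N.
  by rewrite -sum1dep_card big_mkcondr; apply: eq_bigr => c' _; case: (_ \in B _).
apply: leq_trans (Bb pi); rewrite -(card_imset (B pi) (@perm_inj _ (pi l)^-1%g)).
apply/subset_leq_card/fintype.subsetP => c'; rewrite inE => /andP[_ h].
by apply/imsetP; exists (pi l c') => //; rewrite permK.
Qed.

End Exposure.

(** * Averaging over swaps along a list of edges *)

Section Swapping.
Variables (n d : nat).
Notation edge := ('I_d * 'I_n * 'I_n)%type.
Implicit Types (pi : perms n d) (l k : 'I_d) (a b c : 'I_n) (es : seq edge).

Definition pos pi (p : 'I_d * 'I_n) : 'I_n := pi p.1 p.2.

(** An edge [(l, a, b)] stands for the possible swap of [pi l a] and [pi l b]; its slots are these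
    two positions. *)
Fixpoint slots es : seq ('I_d * 'I_n) :=
  if es is e :: es' then (e.1.1, e.1.2) :: (e.1.1, e.2) :: slots es' else [::].

Lemma size_slots es : size (slots es) = (2 * size es)%N.
Proof. by elim: es => //= e es ->; lia. Qed.

Definition touched es pi := [seq pos pi p | p <- slots es].

(** An edge is compared with the tail [es] alone, so that estimates go by induction on the list, the
    head being exposed last. *)
Definition fresh (e : edge) es pi :=
  (pos pi (e.1.1, e.1.2) \notin touched es pi) &&
  (pos pi (e.1.1, e.2) \notin touched es pi).

Fixpoint fresh_count es pi : nat :=
  if es is e :: es' then fresh e es' pi + fresh_count es' pi else 0.

Lemma pos_twist l a b pi p : p != (l, a) -> p != (l, b) ->
  pos (twist l a b pi) p = pos pi p.
Proof.
case: p => k i; rewrite !xpair_eqE /pos twistE /=.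
by case: (k =P l) => //= _ ia ib; rewrite tpermD // eq_sym.
Qed.

Lemma touched_twist l a b pi es :
  (l, a) \notin slots es -> (l, b) \notin slots es ->
  touched es (twist l a b pi) = touched es pi.
Proof.
move=> ha hb; apply/eq_in_map => p pes; apply: pos_twist.
  by apply: contra ha => /eqP <-.
by apply: contra hb => /eqP <-.
Qed.

Lemma fresh_count_twist l a b pi es :
  (l, a) \notin slots es -> (l, b) \notin slots es ->
  fresh_count es (twist l a b pi) = fresh_count es pi.
Proof.
elim: es => //= e es IH; rewrite !inE !negb_or.
move=> /and3P[a1 a2 a3] /and3P[b1 b2 b3].
by rewrite IH // /fresh touched_twist // !pos_twist // eq_sym.
Qed.

Section RowSums.
Variables (V : zmodType) (x : 'I_n -> V).

(** Entry [j] of the row vector [x] times the sum of the permutation matrices. *)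
Definition colsum pi j : V := \sum_l x ((pi l)^-1%g j).

Lemma colsum_twist_other l a b pi j : j != pi l a -> j != pi l b ->
  colsum (twist l a b pi) j = colsum pi j.
Proof.
move=> ja jb; apply: eq_bigr => k _; rewrite ffunE; case: eqP => // ->.
rewrite invMg permM tpermV tpermD //.
  by apply: contra ja => /eqP ->; rewrite permKV.
by apply: contra jb => /eqP ->; rewrite permKV.
Qed.

Lemma colsum_twist l a b pi :
  colsum (twist l a b pi) (pi l a) = colsum pi (pi l a) - x a + x b.
Proof.
rewrite /colsum (bigD1 l) //= [in RHS](bigD1 l) //= permK ffunE eqxx invMg.
rewrite permM tpermV permK tpermL [x a + _]addrC addrK addrC.
congr (_ + _); apply: eq_bigr => k kl.
by rewrite ffunE (negbTE kl).
Qed.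

Variables (R : realFieldType) (Pred : 'I_n -> V -> bool).

Definition allrows pi : R := [forall j, Pred j (colsum pi j)]%:R.

(** Expectation of [f] when each swap of the list is performed or omitted by an independent fair
    coin. *)
Fixpoint avg es (f : perms n d -> R) pi : R :=
  if es is e :: es' then
    (avg es' f pi + avg es' f (twist e.1.1 e.1.2 e.2 pi)) / 2
  else f pi.

Lemma sum_avg es f : \sum_pi avg es f pi = \sum_pi f pi.
Proof.
elim: es => //= e es IH; rewrite -mulr_suml big_split /= sum_twist IH.
by field.
Qed.

(** Swaps along [es] change no column sum outside the touched rows, so a violation there persists in
    every term of the average. *)
Lemma avg_allrows0 es pi j : uniq (slots es) -> j \notin touched es pi ->
  ~~ Pred j (colsum pi j) -> avg es allrows pi = 0.
Proof.
elim: es pi => [|e es IH] pi /=.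
  move=> _ _ Pj; rewrite /allrows; case: forallP => // /(_ j) h.
  by rewrite h in Pj.
rewrite !inE !negb_or => /and3P[/andP[_ u1] u2 u3] /and3P[j1 j2 j3] Pj.
rewrite !IH ?addr0 ?mul0r // ?touched_twist //.
by rewrite colsum_twist_other.
Qed.

Definition separates (e : edge) :=
  forall j s, ~~ (Pred j (s + x e.1.2) && Pred j (s + x e.2)).

(* When the rows met by an edge are met by no later one, at most one of the two
   positions of the swap along it is compatible with [Pred]. *)
Lemma avg_allrows_le es pi : uniq (slots es) ->
  (forall e, e \in es -> separates e) ->
  avg es allrows pi <= 2^-1 ^+ fresh_count es pi.
Proof.
elim: es pi => [|e es IH] pi /=; first by rewrite /allrows expr0; case: [forall _, _].
rewrite !inE !negb_or => /and3P[/andP[_ u1] u2 u3] sep.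
have sep' e' : e' \in es -> separates e'.
  by move=> h; apply: sep; rewrite inE h orbT.
set pi' := twist _ _ _ pi.
have h1 := IH pi u3 sep'.
have := IH pi' u3 sep'; rewrite fresh_count_twist // => h2.
have [fr|_] := boolP (fresh e es pi); last by rewrite add0n; lra.
rewrite add1n exprS; set y := 2^-1 ^+ _ in h1 h2 *.
have {sep}: separates e by apply: sep; rewrite inE eqxx.
(* For the head edge [(l, a, b)], the sums in row [pi l a] before and after the swap share this
   remainder and differ only by [x a] against [x b]. *)
move/(_ (pi e.1.1 e.1.2) (colsum pi (pi e.1.1 e.1.2) - x e.1.2)).
rewrite subrK -colsum_twist negb_and => /orP[] Pj.
  rewrite (avg_allrows0 _ _ Pj) // ?add0r; first lra.
  by case/andP: fr.
rewrite (avg_allrows0 (pi := pi') (j := pi e.1.1 e.1.2)) // ?touched_twist //.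
  lra.
by case/andP: fr.
Qed.

End RowSums.

Lemma card_slots_le es l :
  (#|[set c | (l, c) \in slots es]| <= 2 * size es)%N.
Proof.
rewrite -size_slots; apply: leq_trans (card_size (slots es)).
rewrite -(@card_imset _ _ (fun c => (l, c))) => [|c c' [] //].
by apply/subset_leq_card/fintype.subsetP => p /imsetP[c]; rewrite inE => h ->.
Qed.

(** The tail touches at most [n / 5] values, so each end of the head edge meets one of them with
    conditional probability at most [1/4]. The gain [2^-1] is then lost with probability at most
    [1/2], and each edge costs a factor [1/2 + 1/8 + 1/8 = 3/4]. *)
Lemma sum_fresh_count (R : realFieldType) es : uniq (slots es) ->
  (10 * size es <= n)%N ->
  \sum_pi (2^-1 : R) ^+ fresh_count es pi
    <= (3 / 4) ^+ size es * #|{: perms n d}|%:R.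
Proof.
elim: es => [_ _|e es IH] /=.
  by rewrite mul1r sumr_const.
rewrite !inE !negb_or => /and3P[/andP[ab u1] u2 u3] sz.
set F := fun pi : perms n d => (2^-1 : R) ^+ fresh_count es pi.
have F0 pi : 0 <= F pi by rewrite exprn_ge0 // invr_ge0.
set l := e.1.1; pose D := [set c | (l, c) \in slots es].
pose B pi := [set c in touched es pi].
have cB pi : (#|B pi| <= 2 * size es)%N.
  rewrite -size_slots -(size_map (pos pi)) cardsE; exact: card_size.
have cD : (#|D| <= 2 * size es)%N := card_slots_le es l.
have ex c : (l, c) \notin slots es ->
    \sum_pi F pi *+ (pi l c \in B pi) <= 4^-1 * \sum_pi F pi.
  move=> cs.
  have inv c' pi : c' \notin D -> F (twist l c c' pi) = F pi.
    by rewrite inE => c'D; rewrite /F fresh_count_twist.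
  have inv2 c' pi : c' \notin D -> B (twist l c c' pi) = B pi.
    by rewrite inE => c'D; rewrite /B touched_twist.
  have := expose F0 inv inv2 cB.
  set X := \sum_pi _; set Y := \sum_pi _ => h.
  have X0 : 0 <= X by apply: sumr_ge0 => pi _; apply: mulrn_wge0.
  have h4 : (4 * (2 * size es) <= n - #|D|)%N by lia.
  have h5 : (0 < n - #|D|)%N by lia.
  have h6 : (4 * (2 * size es))%:R * Y <= (n - #|D|)%:R * Y.
    by rewrite ler_wpM2r ?ler_nat // sumr_ge0.
  rewrite natrM -mulrA in h6.
  have h7 : 0 < (n - #|D|)%:R :> R by rewrite ltr0n.
  rewrite -(ler_pM2l h7); nra.
have IH' : \sum_pi F pi <= (3 / 4) ^+ size es * #|{: perms n d}|%:R.
  by apply: IH => //; lia.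
apply: (@le_trans _ _ (3 / 4 * \sum_pi F pi)); last first.
  by rewrite exprS -[X in _ <= X]mulrA ler_wpM2l // divr_ge0.
pose Fa pi := F pi *+ (pi l e.1.2 \in B pi).
pose Fb pi := F pi *+ (pi l e.2 \in B pi).
apply: (@le_trans _ _ (\sum_pi (2^-1 * F pi + 2^-1 * Fa pi + 2^-1 * Fb pi))).
  apply: ler_sum => pi _; rewrite exprD -/(F pi).
  have Fp := F0 pi.
  rewrite /Fa /Fb /B !inE /fresh /pos /= -/l.
  by case: (_ \in _); case: (_ \in _); rewrite /= ?expr0 ?expr1 ?mulr1n ?mulr0n; lra.
rewrite !big_split /= -!mulr_sumr.
have := ex _ u1; have := ex _ u2; rewrite -/(Fa _) /Fa /Fb.
set X := \sum_pi F pi; lra.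
Qed.

Lemma card_allrows_le (R : realFieldType) (V : zmodType) (x : 'I_n -> V)
    (Pred : 'I_n -> V -> bool) es :
  uniq (slots es) -> (10 * size es <= n)%N ->
  (forall e, e \in es -> separates x Pred e) ->
  #|[set pi | [forall j, Pred j (colsum x pi j)]]|%:R
    <= (3 / 4 : R) ^+ size es * #|{: perms n d}|%:R.
Proof.
move=> us sz sep; apply: le_trans (sum_fresh_count R us sz).
rewrite -sum1dep_card natr_sum big_mkcond /=.
have -> : \sum_pi (if [forall j, Pred j (colsum x pi j)] then 1 else 0)
    = \sum_pi allrows x R Pred pi.
  by apply: eq_bigr => pi _; rewrite /allrows; case: ifP.
by rewrite -(sum_avg es); apply: ler_sum => pi _; apply: avg_allrows_le.
Qed.

End Swapping.

(** * Families of disjoint pairs, used in all the permutations at once *)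

Section PairFamilies.
Variables (n d k : nat) (a b : 'I_k -> 'I_n).
Hypotheses (inja : injective a) (injb : injective b).
Hypothesis disj : forall s t, a s != b t.
Implicit Types (pi : perms n d) (qs : seq ('I_d * 'I_k)).

Definition edges qs := [seq (q.1, a q.2, b q.2) | q <- qs].

Lemma slots_edgesP qs (p : 'I_d * 'I_n) : p \in slots (edges qs) ->
  exists2 q, q \in qs & p = (q.1, a q.2) \/ p = (q.1, b q.2).
Proof.
elim: qs => //= q qs IH; rewrite !inE => /or3P[/eqP->|/eqP->|/IH[q' h1 h2]].
- by exists q; [rewrite inE eqxx|left].
- by exists q; [rewrite inE eqxx|right].
- by exists q' => //; rewrite inE h1 orbT.
Qed.

Lemma uniq_slots_edges qs : uniq qs -> uniq (slots (edges qs)).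
Proof.
elim: qs => //= q qs IH /andP[qqs uqs]; rewrite IH // andbT inE negb_or.
rewrite -andbA xpair_eqE eqxx /= disj /=; apply/andP; split; apply/negP.
  move=> /slots_edgesP[[l t] h]; case=> -[e1 e2].
    by move/inja: e2 => e2; move: qqs; rewrite [q]surjective_pairing e1 e2 h.
  by move: (disj q.2 t); rewrite e2 eqxx.
move=> /slots_edgesP[[l t] h]; case=> -[e1 e2].
  by move: (disj t q.2); rewrite e2 eqxx.
by move/injb: e2 => e2; move: qqs; rewrite [q]surjective_pairing e1 e2 h.
Qed.

(** The [k] disjoint pairs, each available in all [d] permutations, provide [d * k] edges with
    distinct slots; [T] of them are used. *)
Lemma card_allrows_edges_le (R : realFieldType) (V : zmodType) (x : 'I_n -> V)
    (Pred : 'I_n -> V -> bool) (T : nat) :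
  (T <= d * k)%N -> (10 * T <= n)%N ->
  (forall s j y, ~~ (Pred j (y + x (a s)) && Pred j (y + x (b s)))) ->
  #|[set pi : perms n d | [forall j, Pred j (colsum x pi j)]]|%:R
    <= (3 / 4 : R) ^+ T * #|{: perms n d}|%:R.
Proof.
move=> Tdk Tn sep.
have sz : size (edges (take T (enum {: 'I_d * 'I_k}))) = T.
  rewrite size_map size_take -cardE card_prod !card_ord.
  by case: ltnP => // h; apply/eqP; rewrite eqn_leq Tdk h.
rewrite -[in X in _ <= X]sz; apply: card_allrows_le.
- by apply: uniq_slots_edges; rewrite take_uniq // enum_uniq.
- by rewrite sz.
- by move=> e /mapP[q _ ->] j y; apply: sep.
Qed.

Variables (R : realFieldType) (Q : rel 'I_n) (m : nat).
Hypotheses (n0 : (0 < n)%N) (degQ : forall i, (m <= #|[set j | Q i j]|)%N).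
Hypothesis km : (4 * k <= m)%N.

(** An exponential moment: [2^-1] to the power of the number of edges whose two values are related
    by [Q]. *)
Definition weight qs pi : R :=
  \prod_(q <- qs) (if Q (pi q.1 (a q.2)) (pi q.1 (b q.2)) then 2^-1 else 1).

Lemma card_slots_edges_le qs l :
  (#|[set c | (l, c) \in slots (edges qs)]| <= 2 * k)%N.
Proof.
have sub : [set c | (l, c) \in slots (edges qs)] \subset
    (a @: [set: 'I_k]) :|: (b @: [set: 'I_k]).
  apply/fintype.subsetP => c; rewrite !inE => /slots_edgesP[q _ [][_ ->]].
    by rewrite imset_f ?inE.
  by rewrite [X in _ || X]imset_f ?inE ?orbT.
apply: leq_trans (subset_leq_card sub) _.
rewrite mul2n -addnn; apply: leq_trans (leq_card_setU _ _) _.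
by rewrite leq_add // (leq_trans (leq_imset_card _ _)) // cardsT card_ord.
Qed.

Lemma weight_ge0 qs pi : 0 <= weight qs pi.
Proof. by apply: prodr_ge0 => q _; case: ifP => // _; rewrite invr_ge0. Qed.

Lemma weight_twist qs l i j pi :
  (l, i) \notin slots (edges qs) -> (l, j) \notin slots (edges qs) ->
  weight qs (twist l i j pi) = weight qs pi.
Proof.
elim: qs => [|q qs IH]; first by rewrite /weight !big_nil.
rewrite /= !inE !negb_or => /and3P[i1 i2 i3] /and3P[j1 j2 j3].
rewrite /weight !big_cons -/(weight qs _) IH //.
have := @pos_twist n d l i j pi (q.1, a q.2).
have := @pos_twist n d l i j pi (q.1, b q.2).
rewrite /pos /= => hb ha.
by rewrite ha ?hb // eq_sym.
Qed.

Lemma m_le_n : (m <= n)%N.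
Proof.
apply: leq_trans (degQ (Ordinal n0)) _.
by rewrite -[X in (_ <= X)%N]card_ord max_card.
Qed.

(** Expose [pi l b] last. Of the at least [m] values related to [pi l a], at most [2 * k <= m / 2]
    are already taken, so a hit has conditional probability at least [m / (2 * n)], and a hit halves
    the weight. *)
Lemma sum_weight qs : uniq qs ->
  \sum_pi weight qs pi
    <= (1 - m%:R / (4 * n%:R)) ^+ size qs * #|{: perms n d}|%:R.
Proof.
have mn := m_le_n.
have nR : 0 < n%:R :> R by rewrite ltr0n.
have mR : m%:R <= n%:R :> R by rewrite ler_nat.
elim: qs => [_|q qs IH].
  rewrite /weight expr0 mul1r; under eq_bigr do rewrite big_nil.
  by rewrite sumr_const.
move=> uq; have := uniq_slots_edges uq.
move: uq => /= /andP[qqs uqs].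
rewrite !inE !negb_or => /and3P[/andP[_ u1] u2 u3].
set F := weight qs; set l := q.1.
have F0 pi : 0 <= F pi by apply: weight_ge0.
(* The position [(l, a)] of the head edge is frozen as well, because [B] depends on the value
   there. *)
pose D := [set c | (l, c) \in (l, a q.2) :: slots (edges qs)].
pose B (pi : perms n d) := [set j | ~~ Q (pi l (a q.2)) j].
have cB pi : (#|B pi| <= n - m)%N.
  have := cardsC [set j | Q (pi l (a q.2)) j]; rewrite card_ord.
  have -> : ~: [set j | Q (pi l (a q.2)) j] = B pi.
    by apply/setP => j; rewrite !inE.
  by have := degQ (pi l (a q.2)); clear; lia.
have cD : (#|D| <= 2 * k)%N.
  apply: leq_trans (card_slots_edges_le (q :: qs) l).
  apply/subset_leq_card/fintype.subsetP => c; rewrite !inE /=.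
  by case/orP=> ->; rewrite ?orbT.
have ex : \sum_pi F pi *+ (pi l (b q.2) \in B pi)
    <= (1 - m%:R / (2 * n%:R)) * \sum_pi F pi.
  have inv c' pi : c' \notin D -> F (twist l (b q.2) c' pi) = F pi.
    by rewrite inE inE negb_or => /andP[_ h]; rewrite /F weight_twist.
  have inv2 c' pi : c' \notin D -> B (twist l (b q.2) c' pi) = B pi.
    rewrite inE inE negb_or xpair_eqE eqxx /= => /andP[h _].
    by rewrite /B twistE eqxx tpermD // eq_sym.
  have := expose F0 inv inv2 cB.
  set X := \sum_pi _; set Y := \sum_pi _ => h.
  have X0 : 0 <= X by apply: sumr_ge0 => pi _; apply: mulrn_wge0.
  have Y0 : 0 <= Y by apply: sumr_ge0.
  have h1 : (n - 2 * k)%:R * X <= (n - m)%:R * Y.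
    by apply: le_trans h; rewrite ler_wpM2r // ler_nat leq_sub2l.
  have kn : (2 * k <= n)%N by clear -km mn; lia.
  move: h1; rewrite !natrB // natrM.
  have kR : 4 * k%:R <= m%:R :> R by rewrite -natrM ler_nat.
  have k0 : 0 <= k%:R :> R by [].
  set x := n%:R in nR mR *; set y := m%:R in mR kR *; set z := k%:R in kR k0 *.
  move=> h1.
  have p0 : 0 < x - 2 * z by lra.
  rewrite -(ler_pM2l p0); apply: le_trans h1 _.
  rewrite mulrA ler_wpM2r //.
  have -> : (x - 2 * z) * (1 - y / (2 * x)) =
      x - y + (y / 2 - 2 * z) + z * y / x by field; rewrite gt_eqF.
  have : 0 <= z * y / x.
    by apply: divr_ge0; [apply: mulr_ge0; lra|lra].
  lra.
apply: (@le_trans _ _ ((1 - m%:R / (4 * n%:R)) * \sum_pi F pi)); last first.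
  rewrite [size _]/= exprS -[X in _ <= X]mulrA ler_wpM2l ?IH //.
  by rewrite subr_ge0 ler_pdivrMr; lra.
pose Fb pi := F pi *+ (pi l (b q.2) \in B pi).
have -> : \sum_pi weight (q :: qs) pi =
    2^-1 * \sum_pi F pi + 2^-1 * \sum_pi Fb pi.
  rewrite !mulr_sumr -big_split /=; apply: eq_bigr => pi _.
  rewrite /weight big_cons -/(weight qs pi) -/(F pi) /Fb inE -/l.
  by case: ifP => _; rewrite /= ?mulr1n ?mulr0n; field.
move: ex; rewrite -/(Fb _).
have -> : m%:R / (2 * n%:R) = 2 * (m%:R / (4 * n%:R)) :> R.
  by field; rewrite pnatr_eq0 -lt0n.
set X := \sum_pi F pi; set Y := \sum_pi _; set z := m%:R / _; lra.
Qed.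

(** Exponential Markov inequality: if each of the [k] pairs has fewer than [N] hits, the weight is
    at least [2^-1 ^+ (k * N)]. *)
Lemma card_few_hits_le (N : nat) :
  #|[set pi : perms n d | [forall s,
      (#|[set l | Q (pi l (a s)) (pi l (b s))]| < N)%N]]|%:R
    <= 2 ^+ (k * N) * (1 - m%:R / (4 * n%:R)) ^+ (d * k)
       * #|{: perms n d}|%:R :> R.
Proof.
set qs := enum {: 'I_d * 'I_k}.
have sz : size qs = (d * k)%N by rewrite -cardE card_prod !card_ord.
rewrite -sz -mulrA.
apply: (@le_trans _ _ (2 ^+ (k * N) * \sum_pi weight qs pi)); last first.
  by rewrite ler_wpM2l ?exprn_ge0 // sum_weight // enum_uniq.
rewrite -sum1dep_card natr_sum big_mkcond /= mulr_sumr.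
apply: ler_sum => pi _; case: ifP => [/forallP few|_]; last first.
  by rewrite mulr_ge0 ?exprn_ge0 ?weight_ge0.
have -> : weight qs pi = \prod_(s : 'I_k)
    2^-1 ^+ #|[set l | Q (pi l (a s)) (pi l (b s))]|.
  rewrite /weight big_enum /= -(pair_bigA _ (fun l s =>
    if Q (pi l (a s)) (pi l (b s)) then 2^-1 else 1)) /= exchange_big /=.
  apply: eq_bigr => s _; rewrite -big_mkcond /= prodr_const.
  by congr (_ ^+ _); apply: eq_card => l; rewrite !inE.
rewrite mulnC exprM -[X in _ ^+ X](card_ord k) -prodr_const -big_split /=.
have one : \prod_(s in 'I_k) (1 : R) = 1 by rewrite big1_eq.
rewrite -[X in X <= _]one.
apply: ler_prod => s _; rewrite ler01 /=.
rewrite exprVn -lter_pdivrMr ?invr_gt0 ?exprn_gt0 // mul1r invrK.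
by apply: ler_weXn2l; [rewrite ler1n|apply: ltnW].
Qed.

End PairFamilies.

(** * Anti-concentration of subset sums *)

Section Sperner.
Variable R : realFieldType.

(** The Lubell-Yamamoto-Meshalkin inequality, by induction on [#|X|]. If [X] is in [F] then [F] is a
    singleton; otherwise the inequality is averaged over the points [x] of [X], using the members of
    [F] that avoid [x]. *)
Lemma lym (T : finType) (X : {set T}) (F : {set {set T}}) :
  (forall A, A \in F -> A \subset X) ->
  (forall A B, A \in F -> B \in F -> A \subset B -> A = B) ->
  \sum_(A in F) ('C(#|X|, #|A|)%:R^-1 : R) <= 1.
Proof.
move eN : #|X| => N; elim: N X F eN => [|N IH] X F eN FX anti.
  have -> : \sum_(A in F) ('C(0, #|A|)%:R^-1 : R) = #|F|%:R.
    rewrite -sum1_card natr_sum; apply: eq_bigr => A AF.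
    have := subset_leq_card (FX A AF); rewrite eN leqn0 => /eqP ->.
    by rewrite bin0 invr1.
  rewrite (_ : 1 = 1%:R :> R) // ler_nat -(cards1 (finset.set0 : {set T})).
  apply/subset_leq_card/fintype.subsetP => A AF; rewrite inE -cards_eq0.
  by have := subset_leq_card (FX A AF); rewrite eN leqn0.
have [XF|XF] := boolP (X \in F).
  have -> : F = [set X].
    apply/setP => A; rewrite inE; apply/idP/eqP => [AF|-> //].
    by apply: anti => //; apply: FX.
  by rewrite big_set1 eN binn invr1.
(* A set [A] is counted once for each of the [N.+1 - #|A|] points outside it, which is exactly the
   ratio between the two binomial weights, up to [N.+1]. *)
have key : N.+1%:R * \sum_(A in F) ('C(N.+1, #|A|)%:R^-1 : R) =
    \sum_(x in X) \sum_(A in [set A in F | x \notin A]) ('C(N, #|A|)%:R^-1 : R).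
  under [RHS]eq_bigr do rewrite big_set.
  rewrite mulr_sumr (exchange_big_dep (mem F)) /=; last by move=> x A _ /andP[].
  apply: eq_bigr => A AF.
  have -> : \sum_(i in X | (A \in F) && (i \notin A)) ('C(N, #|A|)%:R^-1 : R) =
      #|X :\: A|%:R * 'C(N, #|A|)%:R^-1.
    rewrite mulr_natl -sumr_const; apply: eq_bigl => x.
    by rewrite !inE AF andbC.
  rewrite cardsDS ?FX // eN.
  have lt : (#|A| <= N)%N.
    rewrite -ltnS -eN; apply: proper_card; rewrite finset.properEneq FX // andbT.
    by apply: contra XF => /eqP <-.
  have := mul_bin_down N.+1 #|A|; rewrite succnK => /(congr1 (fun p => p%:R : R)).
  rewrite !natrM => e.
  have h1 : ('C(N.+1, #|A|)%:R : R) != 0 by rewrite pnatr_eq0 -lt0n bin_gt0; lia.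
  have h2 : ('C(N, #|A|)%:R : R) != 0 by rewrite pnatr_eq0 -lt0n bin_gt0.
  apply: (mulIf h1); rewrite mulfVK //; apply: (mulIf h2).
  by rewrite e; field.
have N0 : 0 < N.+1%:R :> R by rewrite ltr0n.
rewrite -(ler_pM2l N0) key mulr1 -eN -sumr_const; apply: ler_sum => x xX.
apply: IH (X :\ x) _ _ _ _.
- by move: eN; rewrite (cardsD1 x) xX; case.
- move=> A; rewrite inE => /andP[AF xA].
  by rewrite finset.subsetD1 FX.
- by move=> A B; rewrite !inE => /andP[? _] /andP[? _]; apply: anti.
Qed.

End Sperner.

Lemma bin_le_center p a : ('C(2 * p, a) <= 'C(2 * p, p))%N.
Proof.
have low k : (k <= p)%N -> ('C(2 * p, p - k) <= 'C(2 * p, p))%N.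
  elim: k => [|k IH] kp; first by rewrite subn0.
  apply: leq_trans (IH (ltnW kp)).
  have e := mul_bin_left (2 * p) (p - k.+1).
  have eq1 : (p - k.+1).+1 = (p - k)%N by lia.
  rewrite eq1 in e.
  have h : (p - k <= 2 * p - (p - k.+1))%N by lia.
  have h0 : (0 < p - k)%N by lia.
  by rewrite -(leq_pmul2l h0) e leq_mul2r h orbT.
have [ap|pa] := leqP a p; first by rewrite -(subKn ap) low ?leq_subr.
have [ap|?] := leqP a (2 * p); last by rewrite bin_small.
rewrite -bin_sub //.
have -> : (2 * p - a = p - (a - p))%N by lia.
by apply: low; lia.
Qed.

(** The bound of ['C(2 * p, p) / 4 ^ p] by [1 / sqrt (2 * p + 1)], squared to stay in the integers.
    The induction step reduces to [(2 * p + 1) * (2 * p + 3) <= (2 * p + 2) ^ 2]. *)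
Lemma bin_center_sq p : ('C(2 * p, p) ^ 2 * (2 * p + 1) <= 16 ^ p)%N.
Proof.
elim: p => [//|p IH].
have e1 := mul_bin_diag (2 * p).+1 p.
have e2 := mul_bin_down (2 * p).+1 p.
have e3 := mul_bin_left (2 * p).+1 p.
rewrite !succnK in e1 e2.
have -> : (2 * p.+1 = (2 * p).+2)%N by lia.
have eS : (2 * p).+1 = (2 * p + 1)%N by lia.
have e4 := binS (2 * p).+1 p.
have h1 : ('C((2 * p).+2, p.+1) * p.+1 = 2 * (2 * p + 1) * 'C(2 * p, p))%N.
  have : ((2 * p).+1 - p = p.+1)%N by lia.
  move=> h; rewrite h in e2 e3.
  have : ('C((2 * p).+1, p.+1) = 'C((2 * p).+1, p))%N.
    by apply/eqP; rewrite -(eqn_pmul2l (ltn0Sn p)) e3.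
  nia.
move: IH h1; set c := 'C(2 * p, p); set c' := 'C(_, _) => IH h1.
have h2 : (c' ^ 2 * (2 * p + 3) * p.+1 ^ 2 <= 16 ^ p.+1 * p.+1 ^ 2)%N.
  have -> : (c' ^ 2 * (2 * p + 3) * p.+1 ^ 2 = (c' * p.+1) ^ 2 * (2 * p + 3))%N.
    by rewrite expnMn; ring.
  rewrite h1 [(16 ^ p.+1)%N]expnS.
  have -> : ((2 * (2 * p + 1) * c) ^ 2 * (2 * p + 3) =
     c ^ 2 * (2 * p + 1) * (4 * (2 * p + 1) * (2 * p + 3)))%N by ring.
  have := leq_mul IH (leqnn (4 * (2 * p + 1) * (2 * p + 3))).
  move/leq_trans; apply.
  rewrite [X in (_ <= X)%N](_ : _ = 16 ^ p * (16 * p.+1 ^ 2))%N; last by ring.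
  rewrite leq_mul2l; apply/orP; right.
  by rewrite -mulnn; clear; nia.
have <- : (2 * p + 3 = (2 * p).+2 + 1)%N by lia.
by move: h2; rewrite leq_pmul2r ?expn_gt0.
Qed.

Lemma sperner (T : finType) (X : {set T}) (F : {set {set T}}) p :
  #|X| = (2 * p)%N ->
  (forall A, A \in F -> A \subset X) ->
  (forall A B, A \in F -> B \in F -> A \subset B -> A = B) ->
  (#|F| <= 'C(2 * p, p))%N.
Proof.
move=> eX FX anti; have := lym rat FX anti; rewrite eX => h.
have c0 : 0 < ('C(2 * p, p)%:R : rat) by rewrite ltr0n bin_gt0; lia.
have : #|F|%:R * ('C(2 * p, p)%:R^-1 : rat) <= 1.
  apply: le_trans h; rewrite mulr_natl -sumr_const; apply: ler_sum => A AF.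
  have := subset_leq_card (FX A AF); rewrite eX => lA.
  rewrite lef_pV2 ?posrE ?ltr0n ?bin_gt0 //; last by lia.
  by rewrite ler_nat bin_le_center.
by rewrite ler_pdivrMr // mul1r ler_nat.
Qed.

(** Sort the members of [F] by their trace outside [I]. Within each class the traces on [I] form an
    antichain, to which [sperner] applies, and there are [2 ^ (#|T| - 2 * p)] classes. *)
Lemma sperner_slice (T : finType) (I : {set T}) (F : {set {set T}}) p :
  #|I| = (2 * p)%N ->
  (forall A B, A \in F -> B \in F -> A \subset B -> B :\: A \subset I -> A = B) ->
  (#|F| * 4 ^ p <= 2 ^ #|T| * 'C(2 * p, p))%N.
Proof.
move=> eI anti.
have h : (#|F| <= #|powerset (~: I)| * 'C(2 * p, p))%N.
  rewrite -sum1_card -sum_nat_const.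
  rewrite (partition_big (fun B => B :\: I) (mem (powerset (~: I)))) /=; last first.
    by move=> B _; rewrite powersetE finset.setDE finset.subsetIr.
  apply: leq_sum => O _.
  rewrite sum1dep_card.
  set G := finset _.
  have inj : {in G &, injective (fun B => B :&: I)}.
    move=> A B; rewrite !inE => /andP[_ /eqP hA] /andP[_ /eqP hB] e.
    by rewrite -(finset.setID A I) -(finset.setID B I) e hA hB.
  rewrite -(card_in_imset inj); apply: (sperner eI).
    by move=> _ /imsetP[B _ ->]; apply: finset.subsetIr.
  move=> _ _ /imsetP[A AG ->] /imsetP[B BG ->] sub; congr (_ :&: _).
  move: AG BG; rewrite !inE => /andP[AF /eqP hA] /andP[BF /eqP hB].
  apply: anti => //.
    rewrite -(finset.setID A I) -(finset.setID B I) hA hB.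
    exact: finset.setSU.
  rewrite -(finset.setID A I) -(finset.setID B I) hA hB.
  apply/fintype.subsetP => x; rewrite !inE.
  by case: (x \in O); case: (x \in B); case: (x \in A); case: (x \in I).
apply: leq_trans (leq_mul h (leqnn _)) _.
rewrite card_powerset mulnAC leq_mul2r; apply/orP; right.
have := cardsC I; rewrite eI => e.
have -> : (4 = 2 ^ 2)%N by [].
by rewrite -expnM -expnD leq_exp2l //; move: e; lia.
Qed.

(** * The real-valued complex modulus *)

Section ComplexModulus.
Variable R : rcfType.
Implicit Types (x y z : R[i]).

(** The norm of [R[i]] takes its values in [R[i]]; this version lives in [R], where linear
    arithmetic is available. *)
Definition cabs z : R := Num.sqrt (complex.Re z ^+ 2 + complex.Im z ^+ 2).

Lemma cabsE z : `|z| = (cabs z)%:C.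
Proof. exact: normc_def. Qed.

Lemma cabs_ge0 z : 0 <= cabs z.
Proof. exact: sqrtr_ge0. Qed.

Lemma cabsD x y : cabs (x + y) <= cabs x + cabs y.
Proof. by rewrite -lecR rmorphD /= -!cabsE ler_normD. Qed.

Lemma cabsM x y : cabs (x * y) = cabs x * cabs y.
Proof.
have [] // : (cabs (x * y))%:C = (cabs x * cabs y)%:C.
by rewrite rmorphM /= -!cabsE normrM.
Qed.

Lemma cabsN x : cabs (- x) = cabs x.
Proof. by rewrite /cabs !raddfN !sqrrN. Qed.

Lemma cabsBC x y : cabs (x - y) = cabs (y - x).
Proof. by rewrite -cabsN opprB. Qed.

Lemma cabsB x y : cabs (x - y) <= cabs x + cabs y.
Proof. by rewrite -(cabsN y) cabsD. Qed.

Lemma cabs_tri z x y : cabs (x - y) <= cabs (x - z) + cabs (z - y).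
Proof. by have := cabsD (x - z) (z - y); rewrite addrA subrK. Qed.

Lemma cabs0 : cabs 0 = 0.
Proof. by rewrite /cabs /= expr0n addr0 sqrtr0. Qed.

Lemma cabs0_eq0 z : cabs z = 0 -> z = 0.
Proof. by move=> z0; apply/eqP; rewrite -normr_eq0 cabsE z0. Qed.

Lemma cabsR (r : R) : cabs r%:C = `|r|.
Proof. by rewrite /cabs /= expr0n addr0 sqrtr_sqr. Qed.

Lemma cabs1 : cabs 1 = 1.
Proof. by rewrite -[1]/(1%:C) cabsR normr1. Qed.

Lemma cabs_nat m : cabs m%:R = m%:R.
Proof.
have -> : m%:R = (m%:R : R)%:C by rewrite rmorph_nat.
by rewrite cabsR normr_nat.
Qed.

Lemma cabsV z : cabs z^-1 = (cabs z)^-1.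
Proof.
have [] // : (cabs z^-1)%:C = ((cabs z)^-1)%:C.
by rewrite fmorphV /= -!cabsE normfV.
Qed.

Lemma cabs_sum (I : Type) (r : seq I) (P : pred I) (F : I -> R[i]) :
  cabs (\sum_(i <- r | P i) F i) <= \sum_(i <- r | P i) cabs (F i).
Proof.
elim/big_ind2: _ => [|x s y t xs yt|//]; first by rewrite cabs0.
exact: le_trans (cabsD _ _) (lerD xs yt).
Qed.

Lemma cabs_sum_le (I : finType) (F : I -> R[i]) (c : R) :
  (forall i, cabs (F i) <= c) -> cabs (\sum_i F i) <= #|I|%:R * c.
Proof.
move=> Fc; apply: le_trans (cabs_sum _ _ _) _.
by rewrite mulr_natl -sumr_const; apply: ler_sum.
Qed.

Lemma Re_le_cabs z : `|complex.Re z| <= cabs z.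
Proof.
by rewrite -sqrtr_sqr /cabs ler_wsqrtr // lerDl sqr_ge0.
Qed.

Lemma Im_le_cabs z : `|complex.Im z| <= cabs z.
Proof.
by rewrite -sqrtr_sqr /cabs ler_wsqrtr // lerDr sqr_ge0.
Qed.

Lemma cabs_le_ReIm z : cabs z <= `|complex.Re z| + `|complex.Im z|.
Proof.
set a := `|_|; set b := `|_|.
have a0 : 0 <= a := normr_ge0 _.
have b0 : 0 <= b := normr_ge0 _.
rewrite -(@ger0_norm _ (a + b)) ?addr_ge0 // -sqrtr_sqr /cabs ler_wsqrtr //.
rewrite -(real_normK (num_real (complex.Re z))).
rewrite -(real_normK (num_real (complex.Im z))) -/a -/b.
by have := mulr_ge0 a0 b0; rewrite sqrrD; move: a b {a0 b0} => a b; lra.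
Qed.

Lemma Re_sum (I : Type) (r : seq I) (P : pred I) (F : I -> R[i]) :
  complex.Re (\sum_(i <- r | P i) F i) = \sum_(i <- r | P i) complex.Re (F i).
Proof. by apply: (big_morph _ _ (erefl _)) => -[? ?] [? ?]. Qed.

Lemma Im_sum (I : Type) (r : seq I) (P : pred I) (F : I -> R[i]) :
  complex.Im (\sum_(i <- r | P i) F i) = \sum_(i <- r | P i) complex.Im (F i).
Proof. by apply: (big_morph _ _ (erefl _)) => -[? ?] [? ?]. Qed.

End ComplexModulus.

(** * The Littlewood-Offord inequality *)

Section LittlewoodOfford.
Variables (R : rcfType) (d : nat).

(** Erdos's argument: after flipping the indices with negative coefficients all steps are
    nonnegative, so two comparable sets that differ inside [I] have sums at least [delta] apart, and
    both cannot lie in an interval of length [2 * r]. *)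
Lemma littlewood_offord_real (a : 'I_d -> R) (I : {set 'I_d}) p (delta r s : R) :
  #|I| = (2 * p)%N -> (forall l, l \in I -> delta <= `|a l|) -> 2 * r < delta ->
  (#|[set A : {set 'I_d} | (`|\sum_(l in A) a l - s| <= r)%R]| * 4 ^ p
    <= 2 ^ d * 'C(2 * p, p))%N.
Proof.
move=> eI aI rd; set E := finset _.
pose Neg := [set l | a l < 0].
(* Symmetric difference with [Neg]: it turns the sum over [A] into a sum of moduli, up to a constant
   independent of [A]. *)
pose phi A : {set 'I_d} := (A :\: Neg) :|: (Neg :\: A).
have phiK : involutive phi.
  move=> A; apply/setP => l; rewrite !inE.
  by case: (l \in A); case: (a l < 0).
have phiS A : \sum_(l in phi A) `|a l| =
    \sum_(l in A) a l + \sum_(l in Neg) `|a l|.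
  rewrite [LHS]big_mkcond [X in X + _]big_mkcond [X in _ + X]big_mkcond /=.
  rewrite -big_split /=; apply: eq_bigr => l _; rewrite !inE.
  have [al|al] := ltrP (a l) 0; rewrite ?(ltr0_norm al) ?(ger0_norm al) //=.
    by case: (l \in A); rewrite /= ?addr0 ?add0r ?subrr.
  by case: (l \in A); rewrite /= ?addr0 ?add0r.
rewrite -[X in (2 ^ X)%N](card_ord d) -(card_imset _ (inv_inj phiK)).
apply: (sperner_slice eI) => B1 B2 /imsetP[A1 A1E ->] /imsetP[A2 A2E ->] sub subI.
apply/eqP; rewrite finset.eqEsubset sub /=; apply/fintype.subsetP => l l2.
apply/negPn/negP => l1.
have lD : l \in phi A2 :\: phi A1 by rewrite inE l1.
have dl : delta <= `|a l| by apply: aI; apply: (fintype.subsetP subI).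
have : \sum_(l in phi A2) `|a l| =
    \sum_(l in phi A1) `|a l| + \sum_(l in phi A2 :\: phi A1) `|a l|.
  by rewrite (big_setID (phi A1)) /=; move/finset.setIidPr: sub => ->.
have : delta <= \sum_(l in phi A2 :\: phi A1) `|a l|.
  by rewrite (bigD1 l) //=; apply: ler_wpDr => //; apply: sumr_ge0.
rewrite !phiS; move: A1E A2E; rewrite !inE !ler_norml.
move: (\sum_(i in A1) a i) (\sum_(i in A2) a i) (\sum_(i in Neg) _)
  (\sum_(i in _ :\: _) _) => S1 S2 S3 S4 {eI}.
move=> /andP[? ?] /andP[? ?] ? ?; lra.
Qed.

Lemma subset_of_card (T : finType) (A : {set T}) m : (m <= #|A|)%N ->
  exists2 B : {set T}, B \subset A & #|B| = m.
Proof.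
move=> mA; exists [set x in take m (enum A)].
  by apply/fintype.subsetP => x; rewrite inE => /mem_take; rewrite mem_enum.
rewrite cardsE; move/card_uniqP: (take_uniq m (enum_uniq (mem A))) => ->.
by rewrite size_takel // -cardE.
Qed.

(** A coefficient of modulus at least [delta] has a real or an imaginary part of size at least
    [delta / 2]; one of the two cases holds for [2 * p] indices, and the real inequality is applied
    to that part. *)
Lemma littlewood_offord (a : 'I_d -> R[i]) (s : R[i]) p (delta r : R) :
  (4 * p <= #|[set l | (delta <= cabs (a l))%R]|)%N -> 4 * r < delta ->
  (#|[set A : {set 'I_d} | (cabs (\sum_(l in A) a l - s) <= r)%R]| * 4 ^ p
    <= 2 ^ d * 'C(2 * p, p))%N.
Proof.
move=> cS rd.
pose SR := [set l | delta / 2 <= `|complex.Re (a l)|].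
pose SI := [set l | delta / 2 <= `|complex.Im (a l)|].
have cU : (4 * p <= #|SR| + #|SI|)%N.
  apply: leq_trans cS _; apply: leq_trans (leq_card_setU _ _).
  apply/subset_leq_card/fintype.subsetP => l; rewrite !inE => h.
  have := cabs_le_ReIm (a l); move: h; set u := cabs _; set v := `|_|.
  set w := `|_| => h1 h2.
  by have [//|h3] := lerP (delta / 2) v; have [//|h4] := lerP (delta / 2) w; lra.
have [h|h] : (2 * p <= #|SR|)%N \/ (2 * p <= #|SI|)%N by clear -cU; lia.
  have [I IS eI] := subset_of_card h.
  have aI l : l \in I -> delta / 2 <= `|complex.Re (a l)|.
    by move/(fintype.subsetP IS); rewrite inE.
  have rd2 : 2 * r < delta / 2 by lra.
  apply: leq_trans (littlewood_offord_real (complex.Re s) eI aI rd2).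
  rewrite leq_mul2r; apply/orP; right; apply/subset_leq_card/fintype.subsetP => A.
  rewrite !inE -Re_sum => h1; apply: le_trans h1.
  have := Re_le_cabs (\sum_(l in A) a l - s).
  by case: (\sum_(l in A) a l) => ? ?; case: (s).
have [I IS eI] := subset_of_card h.
have aI l : l \in I -> delta / 2 <= `|complex.Im (a l)|.
  by move/(fintype.subsetP IS); rewrite inE.
have rd2 : 2 * r < delta / 2 by lra.
apply: leq_trans (littlewood_offord_real (complex.Im s) eI aI rd2).
rewrite leq_mul2r; apply/orP; right; apply/subset_leq_card/fintype.subsetP => A.
rewrite !inE -Im_sum => h1; apply: le_trans h1.
have := Im_le_cabs (\sum_(l in A) a l - s).
by case: (\sum_(l in A) a l) => ? ?; case: (s).
Qed.

End LittlewoodOfford.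

(** * Elementary bounds for the uniform probability *)

Section UniformProbability.
Variables (R : realType) (n d : nat).
Implicit Types (E F : perms n d -> Prop).

Lemma card_perms_gt0 : 0 < #|{: perms n d}|%:R :> R.
Proof.
rewrite ltr0n; apply/card_gt0P; by exists [ffun=> 1%g].
Qed.

Lemma uprob_le E F : (forall pi, E pi -> F pi) -> uprob R E <= uprob R F.
Proof.
move=> EF; rewrite /uprob ler_pM2r ?invr_gt0 ?card_perms_gt0 // ler_nat.
apply/subset_leq_card/fintype.subsetP => pi; rewrite !inE.
exact: EF.
Qed.

Lemma uprob_le1 E : uprob R E <= 1.
Proof.
rewrite /uprob ler_pdivrMr ?card_perms_gt0 // mul1r ler_nat.
exact: max_card.
Qed.

Lemma uprob_card_le E (A : {set perms n d}) (c : R) :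
  (forall pi, E pi -> pi \in A) ->
  #|A|%:R <= c * #|{: perms n d}|%:R -> uprob R E <= c.
Proof.
move=> EA Ac; rewrite /uprob ler_pdivrMr ?card_perms_gt0 //.
apply: le_trans Ac; rewrite ler_nat.
by apply/subset_leq_card/fintype.subsetP => pi; rewrite !inE; apply: EA.
Qed.

Lemma uprobE E :
  uprob R E = (\sum_(pi : perms n d) (`[< E pi >]%:R : R)) / #|{: perms n d}|%:R.
Proof.
rewrite /uprob -sum1dep_card natr_sum big_mkcond /=; congr (_ / _).
by apply: eq_bigr => pi _; case: `[< _ >].
Qed.

(** Markov's inequality for the number of events [F i] that occur. It gives the union bound when
    [c = 1] and the final averaging over pairs of rows. *)
Lemma uprob_count (I : finType) E (F : I -> perms n d -> Prop) (c : nat) :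
  (forall pi, E pi -> (c <= #|[set i | `[< F i pi >]]|)%N) ->
  c%:R * uprob R E <= \sum_i uprob R (F i).
Proof.
move=> EF; rewrite uprobE (eq_bigr _ (fun i _ => uprobE (F i))).
rewrite -mulr_suml mulrA ler_pM2r ?invr_gt0 ?card_perms_gt0 // exchange_big /=.
rewrite mulr_sumr; apply: ler_sum => pi _; case: asboolP => [Epi|_]; last first.
  by rewrite mulr0 sumr_ge0.
rewrite mulr1 -natr_sum ler_nat; apply: leq_trans (EF pi Epi) _.
by rewrite -sum1dep_card big_mkcond leq_sum // => i _; case: asbool.
Qed.

Lemma uprob_exists (I : finType) (F : I -> perms n d -> Prop) :
  uprob R (fun pi => exists i, F i pi) <= \sum_i uprob R (F i).
Proof.
have := @uprob_count I (fun pi => exists i, F i pi) F 1.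
rewrite mul1r; apply=> pi [i Fi]; apply/card_gt0P; exists i.
by rewrite !inE.
Qed.

Lemma uprob_or E F :
  uprob R (fun pi => E pi \/ F pi) <= uprob R E + uprob R F.
Proof.
have := uprob_exists (fun b : bool => if b then E else F).
rewrite big_bool /=; apply: le_trans; apply: uprob_le => pi [h|h].
  by exists true.
by exists false.
Qed.

Lemma uprob_exists_le (I : finType) (F : I -> perms n d -> Prop) (c : R) :
  (forall i, uprob R (F i) <= c) ->
  uprob R (fun pi => exists i, F i pi) <= #|I|%:R * c.
Proof.
move=> Fc; apply: le_trans (uprob_exists F) _.
by rewrite mulr_natl -sumr_const; apply: ler_sum.
Qed.

Definition inv_perms (pi : perms n d) : perms n d := [ffun l => (pi l)^-1%g].

Lemma inv_permsK : involutive inv_perms.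
Proof. by move=> pi; apply/ffunP => l; rewrite !ffunE invgK. Qed.

(** Inverting all the permutations transposes the matrix, so estimates for left vectors pass to
    right vectors. *)
Lemma uprob_inv E : uprob R (fun pi => E (inv_perms pi)) = uprob R E.
Proof.
by rewrite !uprobE [in RHS](reindex_inj (inv_inj inv_permsK)).
Qed.

Definition swaps (i j : 'I_n) (A : {set 'I_d}) (pi : perms n d) : perms n d :=
  [ffun l => if l \in A then (tperm i j * pi l)%g else pi l].

Lemma swapsK i j A : involutive (swaps i j A).
Proof.
move=> pi; apply/ffunP => l; rewrite !ffunE; case: (l \in A) => //.
by rewrite mulgA tperm2 mul1g.
Qed.

(** The law is invariant under [swaps i j A] for each fixed [A], hence for a uniformly random [A];
    it suffices to bound the probability over [A] with [pi] frozen. *)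
Lemma uprob_swaps_le i j E (c : R) :
  (forall pi, #|[set A | `[< E (swaps i j A pi) >]]|%:R <= c * 2 ^+ d) ->
  uprob R E <= c.
Proof.
move=> Ec; have p2 : 0 < 2 ^+ d :> R by rewrite exprn_gt0.
rewrite uprobE ler_pdivrMr ?card_perms_gt0 // -(ler_pM2r p2).
have -> : (\sum_(pi : perms n d) (`[< E pi >]%:R : R)) * 2 ^+ d =
    \sum_pi \sum_(A : {set 'I_d}) `[< E (swaps i j A pi) >]%:R.
  have inv (A : {set 'I_d}) : \sum_(pi : perms n d)
      (`[< E (swaps i j A pi) >]%:R : R) = \sum_(pi : perms n d) `[< E pi >]%:R.
    by rewrite [RHS](reindex_inj (inv_inj (swapsK i j A))).
  rewrite exchange_big /= [RHS](eq_bigr _ (fun A _ => inv A)) sumr_const.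
  rewrite -[RHS]mulr_natr; congr (_ * _).
  rewrite -natrX; congr (_%:R).
  by rewrite -[X in (2 ^ X)%N](card_ord d) -cardsT -card_powerset powersetT cardsT.
rewrite mulrAC mulr_natr -sumr_const; apply: ler_sum => pi _.
apply: le_trans (Ec pi); rewrite -natr_sum ler_nat -sum1dep_card.
rewrite [X in (_ <= X)%N]big_mkcond.
by rewrite leq_sum // => A _; case: asbool.
Qed.

End UniformProbability.

(** * A grid in the complex unit square *)

Section Grid.
Variables (R : realType) (N : nat).
Hypothesis N0 : (0 < N)%N.

Definition grid := ('I_(2 * N).+1 * 'I_(2 * N).+1)%type.

Definition grid_coord (k : 'I_(2 * N).+1) : R := (k%:R - N%:R) / N%:R.

Definition grid_val (p : grid) : R[i] :=
  Complex (grid_coord p.1) (grid_coord p.2).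

Lemma grid_coordP (t : R) : `|t| <= 1 -> exists k, `|t - grid_coord k| <= N%:R^-1.
Proof.
rewrite ler_norml => /andP[t1 t2].
have NR : 0 < N%:R :> R by rewrite ltr0n.
have x0 : 0 <= (t + 1) * N%:R by apply: mulr_ge0; lra.
have /andP[] := truncn_itv x0; set k := Num.trunc _ => k1 k2.
have kN : (k < (2 * N).+1)%N.
  by rewrite ltnS -(ler_nat R) natrM; apply: le_trans k1 _; nra.
exists (Ordinal kN); rewrite /grid_coord /=.
have -> : t - (k%:R - N%:R) / N%:R = ((t + 1) * N%:R - k%:R) / N%:R.
  by field; rewrite gt_eqF.
rewrite normrM normfV (gtr0_norm NR) ler_pdivrMr // mulVf ?gt_eqF //.
by rewrite ger0_norm; move: k1 k2; rewrite -natr1; lra.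
Qed.

Lemma gridP (z : R[i]) : cabs z <= 1 ->
  exists p, cabs (z - grid_val p) <= 2 / N%:R.
Proof.
move=> z1.
have [k hk] := grid_coordP (le_trans (Re_le_cabs z) z1).
have [k' hk'] := grid_coordP (le_trans (Im_le_cabs z) z1).
exists (k, k'); apply: le_trans (cabs_le_ReIm _) _.
case: z hk hk' {z1} => u v /= h1 h2.
by have := lerD h1 h2; lra.
Qed.

Lemma card_grid : #|{: grid}| = ((2 * N).+1 ^ 2)%N.
Proof. by rewrite card_prod !card_ord mulnn. Qed.

End Grid.

(** * Nearly null vectors are unstructured *)

Lemma injection_of_card (T : finType) (A : {set T}) m : (m <= #|A|)%N ->
  exists2 a : 'I_m -> T, injective a & forall s, a s \in A.
Proof.
move=> mA; exists (fun s => enum_val (widen_ord mA s)).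
  by move=> s t /enum_val_inj/(congr1 val) /= /val_inj.
by move=> s; apply: enum_valP.
Qed.

Section Structured.
Variables (R : realType) (n d : nat) (w : R[i]).
Implicit Types (pi : perms n d) (x : 'I_n -> R[i]) (rho tau : R).

(** Entry [j] of the row vector [x] times [S - w I]. *)
Definition lrow x pi j : R[i] := colsum x pi j - w * x j.

(* Counts the coordinates of [x] that are not [rho]-close to the [b]-th one:
   when it is small, [x] is nearly constant outside a small set. *)
Definition deg rho x b := #|[set j | rho < cabs (x j - x b)]|.

Section Decode.
Variables (N m : nat).

Definition code := ({ffun 'I_m -> 'I_n * grid N} * grid N)%type.

(** A code lists at most [m] exceptional coordinates with their grid values, and one grid value
    shared by all the others. *)
Definition decode (c : code) (j : 'I_n) : R[i] :=
  if [pick s | (c.1 s).1 == j] is Some s then grid_val R (c.1 s).2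
  else grid_val R c.2.

Lemma card_code :
  #|{: code}| = ((n * (2 * N).+1 ^ 2) ^ m * (2 * N).+1 ^ 2)%N.
Proof. by rewrite card_prod card_ffun card_prod !card_grid !card_ord. Qed.

Lemma decode_exists (J : {set 'I_n}) (g : 'I_n -> grid N) p : #|J| = m ->
  exists c : code, forall j,
    decode c j = grid_val R (if j \in J then g j else p).
Proof.
move=> cJ.
pose f s := enum_val (cast_ord (esym cJ) s).
exists ([ffun s => (f s, g (f s))], p) => j; rewrite /decode.
case: pickP => [s /=|none].
  by rewrite !ffunE /= => /eqP <-; rewrite enum_valP.
case: ifP => // jJ; have := none (cast_ord cJ (enum_rank_in jJ j)).
by rewrite ffunE /= /f cast_ordK enum_rankK_in // eqxx.
Qed.

End Decode.

Definition near_null x pi tau :=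
  (forall j, cabs (x j) <= 1) /\ (forall j, cabs (lrow x pi j) <= tau).

(** Union bound over codes. Rounding [x] to a code moves coordinates by at most [2 * rho'] and so
    keeps every row below [5 * d%:R * rho'], while [m'] exceptional coordinates stay more than twice
    that far from typical ones; swapping within such a pair breaks the row constraint. *)
Lemma uprob_jump rho rho' tau (N m m' T : nat) :
  (0 < N)%N -> 2 / N%:R <= rho' -> cabs w <= d%:R -> tau <= d%:R * rho' ->
  16 * d%:R * rho' <= rho -> (0 < d)%N -> (m' <= n - m)%N ->
  (T <= d * m')%N -> (10 * T <= n)%N ->
  uprob R (fun pi => exists x, near_null x pi tau /\
     exists b, deg rho' x b = m /\ (m' <= deg rho x b)%N)
  <= ((n * (2 * N).+1 ^ 2) ^ m * (2 * N).+1 ^ 2)%:R * (3 / 4) ^+ T.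
Proof.
move=> N0 Nrho wd td rr d0 m'm Td Tn.
have dR : 1 <= d%:R :> R by rewrite ler1n.
have r0 : 0 < rho'.
  by apply: lt_le_trans Nrho; rewrite divr_gt0 // ltr0n.
have dr : rho' <= d%:R * rho' by rewrite ler_peMl // ltW.
(* [bnd] is an opaque name for [d%:R * rho'], which keeps the later inequalities linear. *)
move: td rr dr; rewrite -mulrA; have [bnd eb] : exists y, y = d%:R * rho' by eexists.
rewrite -eb => td rr dr.
pose ok (c : code N m) (pi : perms n d) :=
  (exists a b : 'I_m' -> 'I_n, [/\ injective a, injective b,
     forall s t, a s != b t &
     forall s t, 10 * bnd < cabs (decode c (a s) - decode c (b t))]) /\
  (forall j, cabs (lrow (decode c) pi j) <= 5 * bnd).
rewrite -card_code.
apply: (@le_trans _ _ (uprob R (fun pi => exists c, ok c pi))); last first.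
  apply: uprob_exists_le => c.
  (* The existence of separated pairs depends on the code alone, not on [pi]; without them the event
     is empty. *)
  have [[a [b [inja injb ab sep]]]|none] := pselect (exists a b : 'I_m' -> 'I_n,
     [/\ injective a, injective b, forall s t, a s != b t &
     forall s t, 10 * bnd < cabs (decode c (a s) - decode c (b t))]); last first.
    apply: (@uprob_card_le _ _ _ _ finset.set0) => [pi [] //|].
    by rewrite cards0 mulr_ge0 // exprn_ge0 // divr_ge0.
  pose Pred j y := cabs (y - w * decode c j) <= 5 * bnd.
  apply: uprob_card_le (card_allrows_edges_le (x := decode c) (Pred := Pred)
    inja injb ab R Td Tn _).
    by move=> pi [_ h]; rewrite inE; apply/forallP => j; apply: h.
  move=> s j y; apply/negP => /andP[]; rewrite /Pred => h1 h2.
  have := sep s s; rewrite ltNge => /negP; apply.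
  have -> : decode c (a s) - decode c (b s) =
    (y + decode c (a s) - w * decode c j) - (y + decode c (b s) - w * decode c j).
    by ring.
  by apply: le_trans (cabsB _ _) _; lra.
apply: uprob_le => pi [x [[x1 xt] [b [eJ bJ]]]].
set J := [set j | rho' < cabs (x j - x b)] in eJ.
have [g gP] := fin_all_exists (fun j => gridP N0 (x1 j)).
have [c cP] := decode_exists g (g b) eJ.
have r'r : rho' <= rho by lra.
have err j : cabs (decode c j - x j) <= 2 * rho'.
  rewrite cP inE; case: ltP => [_|h].
    by rewrite cabsBC; have := gP j; lra.
  have := cabs_tri (x b) (grid_val R (g b)) (x j).
  rewrite [cabs (x b - x j)]cabsBC [cabs (grid_val R (g b) - x b)]cabsBC.
  by have := gP b; lra.
exists c; split.
  have [a inja aJ] := injection_of_card bJ.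
  have : (m' <= #|~: J|)%N.
    by have := cardsC J; rewrite card_ord; move: m'm eJ; rewrite /deg -/J; clear; lia.
  move/injection_of_card => [b' injb bJ'].
  have aJ' s : a s \in J.
    by have := aJ s; rewrite !inE; apply: le_lt_trans.
  exists a, b'; split => // s t.
    by apply: contraTneq (aJ' s) => ->; have := bJ' t; rewrite inE.
  rewrite !cP aJ'; have := bJ' t; rewrite finset.in_setC => /negbTE ->.
  have := aJ s; rewrite inE.
  have := cabs_tri (grid_val R (g (a s))) (x (a s)) (x b).
  have := cabs_tri (grid_val R (g b)) (grid_val R (g (a s))) (x b).
  have := gP b; have := gP (a s).
  rewrite [cabs (grid_val R (g b) - x b)]cabsBC.
  by lra.
move=> j.
have -> : lrow (decode c) pi j = lrow x pi j +
    \sum_l (decode c ((pi l)^-1%g j) - x ((pi l)^-1%g j))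
    - w * (decode c j - x j).
  by rewrite sumrB /lrow /colsum mulrBr; ring.
apply: le_trans (cabsB _ _) _; apply: le_trans (lerD (cabsD _ _) (lexx _)) _.
rewrite cabsM.
have h1 : cabs (\sum_l (decode c ((pi l)^-1%g j) - x ((pi l)^-1%g j)))
    <= d%:R * (2 * rho').
  by rewrite -[X in X%:R * _](card_ord d); apply: cabs_sum_le => l; apply: err.
have h2 : cabs w * cabs (decode c j - x j) <= d%:R * (2 * rho').
  by apply: ler_pM => //; apply: cabs_ge0.
by have := xt j; move: h1 h2; rewrite mulrCA -eb; lra.
Qed.

Lemma uprob_le_const E (c : R) : (forall pi, ~ E pi) -> 0 <= c ->
  uprob R (E : perms n d -> Prop) <= c.
Proof.
move=> nE c0; apply: (@uprob_card_le _ _ _ _ finset.set0) => [pi /nE //|].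
by rewrite cards0 mulr_ge0.
Qed.

(** * Growth of the degree along decreasing scales *)

Section Scales.
Variables (P tau : R) (K q mx : nat).
Hypotheses (d0 : (0 < d)%N) (P16 : 16 * d%:R <= P).
Hypotheses (q0 : (0 < q)%N) (qK : (n <= q ^ K)%N) (mxn : (2 * mx <= n)%N).
Hypothesis wd : cabs w <= d%:R / 2.

Definition scale k : R := P^-1 ^+ k.+1.

Hypothesis tauK : tau <= d%:R * scale K.

Lemma d_ge1 : 1 <= d%:R :> R.
Proof. by rewrite ler1n. Qed.

Lemma P_ge16 : 16 <= P.
Proof. by have := d_ge1; have := P16; lra. Qed.

Lemma P_gt0 : 0 < P. Proof. by have := P_ge16; lra. Qed.

Lemma scale_gt0 k : 0 < scale k.
Proof. by rewrite exprn_gt0 // invr_gt0 P_gt0. Qed.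

Lemma scaleS k : scale k = P * scale k.+1.
Proof. by rewrite /scale [P^-1 ^+ k.+2]exprS mulrA divff ?mul1r // gt_eqF ?P_gt0. Qed.

Lemma scale_jump k : 16 * d%:R * scale k.+1 <= scale k.
Proof. by rewrite [scale k]scaleS ler_pM2r ?scale_gt0. Qed.

Lemma scale_le k k' : (k <= k')%N -> scale k' <= scale k.
Proof.
move=> kk'; rewrite /scale; apply: ler_wiXn2l; rewrite ?invr_ge0 ?(ltW P_gt0) //.
by rewrite invf_le1 ?P_gt0 //; have := P_ge16; lra.
Qed.

Lemma deg_le rho rho' x b : rho' <= rho -> (deg rho x b <= deg rho' x b)%N.
Proof.
move=> h; apply/subset_leq_card/fintype.subsetP => j; rewrite !inE.
exact: le_lt_trans.
Qed.

(** A nearly constant vector is not nearly null: its column sums are close to [d%:R * x b], of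
    modulus at least [15/16 * d], and the term [w * x i] is at most [d / 2]. *)
Lemma deg_scale0_gt0 x pi b : (exists i, 1 <= cabs (x i)) ->
  near_null x pi tau -> (0 < deg (scale 0) x b)%N.
Proof.
move=> [i xi] [x1 xt]; rewrite lt0n; apply/negP => /eqP/cards0_eq deg0.
have s0 : scale 0 <= 16^-1.
  rewrite /scale expr1 lef_pV2 ?posrE ?P_gt0 ?P_ge16 //.
have close j : cabs (x j - x b) <= scale 0.
  rewrite leNgt; apply/negP => h.
  by have := finset.in_set0 j; rewrite -deg0 inE h.
have s0p := scale_gt0 0.
have xb : 15 / 16 <= cabs (x b).
  have := cabsD (x i - x b) (x b); rewrite subrK => h.
  by have := close i; lra.
have := xt i.
have e : lrow x pi i = (d%:R * x b + \sum_l (x ((pi l)^-1%g i) - x b)) - w * x i.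
  rewrite /lrow /colsum sumrB sumr_const card_ord mulr_natl; ring.
have h1 : cabs (d%:R * x b) <= cabs (lrow x pi i) +
    cabs (\sum_l (x ((pi l)^-1%g i) - x b)) + cabs (w * x i).
  have -> : d%:R * x b = lrow x pi i + w * x i - \sum_l (x ((pi l)^-1%g i) - x b).
    by rewrite e; ring.
  apply: le_trans (cabsB _ _) _; rewrite [X in _ <= X]addrAC lerD2r; exact: cabsD.
have h2 : cabs (\sum_l (x ((pi l)^-1%g i) - x b)) <= d%:R * scale 0.
  by rewrite -[X in X%:R * _](card_ord d); apply: cabs_sum_le => l; apply: close.
have h3 : cabs (w * x i) <= d%:R / 2.
  by rewrite cabsM -[X in _ <= X]mulr1; apply: ler_pM => //; apply: cabs_ge0.
have d1 := d_ge1.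
have h4 : tau <= d%:R * scale 0.
  by apply: le_trans tauK _; rewrite ler_pM2l ?scale_le //; lra.
have h5 : d%:R * scale 0 <= d%:R * 16^-1 by rewrite ler_pM2l //; lra.
have h6 : d%:R * (15 / 16) <= d%:R * cabs (x b) by rewrite ler_pM2l //; lra.
move: h1; rewrite cabsM cabs_nat => h1 h7.
move: h1 h2 h3 h4 h5 h6 h7 d1.
move: (cabs (lrow _ _ _)) (cabs (\sum_l _)) (cabs (w * _)) (d%:R * cabs _).
by move: (d%:R * scale 0) => u1 u2 u3 u4 u5; lra.
Qed.

(** Let [mu k] be the least degree at scale [k]. It starts above [0], and growth by a factor [q] at
    all [K] steps would give [n <= mu K < mx]. At a step where growth fails, minimality lets one
    centre [b] serve both scales. *)
Lemma structured_jump x pi b0 : (exists i, 1 <= cabs (x i)) ->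
  near_null x pi tau -> (deg (scale K) x b0 < mx)%N ->
  exists (k : 'I_K) (m : 'I_mx) b,
    deg (scale k.+1) x b = m /\ (m %/ q < deg (scale k) x b)%N.
Proof.
move=> xi xn b0mx.
pose bmin k := [arg min_(b < b0) deg (scale k) x b].
pose mu k := deg (scale k) x (bmin k).
have mu_min k b : (mu k <= deg (scale k) x b)%N.
  by rewrite /mu /bmin; case: arg_minnP => // c _; apply.
have muK k : (k <= K)%N -> (mu k < mx)%N.
  move=> kK; apply: leq_ltn_trans b0mx; apply: leq_trans (mu_min k b0) _.
  exact/deg_le/scale_le.
have [/existsP[k hk]|/existsPn none] :=
    boolP [exists k : 'I_K, (mu k.+1 < q * mu k)%N].
  have hm : (mu k.+1 < mx)%N by apply: muK.
  exists k, (Ordinal hm), (bmin k.+1); split => //=.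
  apply: leq_trans (mu_min k (bmin k.+1)).
  by rewrite ltn_divLR // mulnC.
have grow k : (k <= K)%N -> (q ^ k <= mu k)%N.
  elim: k => [_|k IH kK]; first exact: deg_scale0_gt0 xi xn.
  have := none (Ordinal kK); rewrite -leqNgt /= => h.
  by apply: leq_trans h; rewrite expnS leq_mul2l IH ?orbT // ltnW.
have := grow K (leqnn K); have := muK K (leqnn K); move: qK mxn.
by clear; lia.
Qed.

Lemma uprob_structured (N : nat) (c : R) :
  (0 < N)%N -> 2 / N%:R <= scale K ->
  (forall m, (m < mx)%N ->
    ((n * (2 * N).+1 ^ 2) ^ m * (2 * N).+1 ^ 2)%:R *
      (3 / 4) ^+ minn (d * (m %/ q).+1) (n %/ 10) <= c) ->
  uprob R (fun pi => exists x, [/\ exists i, 1 <= cabs (x i),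
     near_null x pi tau & exists b, (deg (scale K) x b < mx)%N])
  <= (K * mx)%:R * c.
Proof.
move=> N0 NK cm.
pose ev (p : 'I_K * 'I_mx) pi := exists x, near_null x pi tau /\
  exists b, deg (scale p.1.+1) x b = p.2 /\ ((p.2 %/ q).+1 <= deg (scale p.1) x b)%N.
apply: (@le_trans _ _ (uprob R (fun pi => exists p, ev p pi))).
  apply: uprob_le => pi [x [xi xn [b0 hb]]].
  have [k [m [b [h1 h2]]]] := structured_jump xi xn hb.
  by exists (k, m), x; split => //; exists b.
rewrite -[X in (X * _)%N](card_ord K) -[X in (_ * X)%N](card_ord mx) -card_prod.
apply: uprob_exists_le => -[k m]; apply: le_trans (cm m (ltn_ord m)).
apply: uprob_jump => //=.
- by apply: le_trans NK _; apply: scale_le.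
- by apply: le_trans wd _; have := d_ge1; lra.
- apply: le_trans tauK _; rewrite ler_pM2l ?ltr0n //; exact: scale_le.
- exact: scale_jump.
- have := ltn_ord m; have := leq_div m q; move: mxn; clear; lia.
- exact: geq_minl.
- apply: leq_trans (leq_mul (leqnn 10) (geq_minr _ _)) _.
  by rewrite mulnC leq_trunc_div.
Qed.

End Scales.

End Structured.

(** * Unstructured nearly null vectors *)

Section Matching.
Variables (n : nat) (bad : rel 'I_n).

(** Greedy choice of disjoint bad pairs: if it stops before [k] pairs, the fewer than [2 * k] points
    used meet every bad pair. *)
Lemma matching_or_cover k :
  (exists a b : 'I_k -> 'I_n, [/\ injective a, injective b,
     forall s t, a s != b t & forall s, bad (a s) (b s)]) \/
  (#|[set p : 'I_n * 'I_n | (p.1 != p.2) && bad p.1 p.2]| <= 4 * k * n)%N.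
Proof.
suff [[ps [sz u al]]|[W cW cov]] :
    (exists ps : seq ('I_n * 'I_n), [/\ size ps = k,
       uniq ([seq p.1 | p <- ps] ++ [seq p.2 | p <- ps]) &
       forall p, p \in ps -> bad p.1 p.2]) \/
    (exists2 W : {set 'I_n}, (#|W| <= 2 * k)%N &
       forall i j, i != j -> bad i j -> (i \in W) || (j \in W)).
- left; move: u; rewrite cat_uniq => /and3P[u1 /hasPn u2 u3].
  pose f (g : 'I_n * 'I_n -> 'I_n) (s : 'I_k) :=
    g (tnth (in_tuple ps) (cast_ord (esym sz) s)).
  have mem s : tnth (in_tuple ps) (cast_ord (esym sz) s) \in ps.
    exact: mem_tnth.
  have inj g : uniq (map g ps) -> injective (f g).
    move=> ug s t.
    have /tuple_uniqP h : uniq (map_tuple g (in_tuple ps)) by [].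
    move=> e; apply: (@cast_ord_inj _ _ (esym sz)); apply: h.
    by rewrite !tnth_map.
  exists (f fst), (f snd); split; [exact: inj|exact: inj| |].
    move=> s t; apply/eqP => e.
    have h : f snd t \in map snd ps by apply: map_f; apply: mem.
    have /negP := u2 _ h; apply.
    by rewrite -e; apply: map_f; apply: mem.
  by move=> s; apply: al; apply: mem.
- right; set S := finset _.
  have sub : S \subset finset.setX W [set: 'I_n] :|: finset.setX [set: 'I_n] W.
    apply/fintype.subsetP => -[i j]; rewrite !inE /= => /andP[ij b].
    by rewrite andbT; apply: cov.
  apply: leq_trans (subset_leq_card sub) _.
  apply: leq_trans (leq_card_setU _ _) _.
  rewrite !cardsX cardsT card_ord [(n * _)%N]mulnC -mulnDl leq_mul2r.
  by apply/orP; right; apply: leq_trans (leq_add cW cW) _; clear; lia.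
elim: k => [|k [[ps [sz u al]]|[W cW cov]]].
- by left; exists [::].
- pose W := [set i in [seq p.1 | p <- ps] ++ [seq p.2 | p <- ps]].
  have [/existsP[i /existsP[j /and4P[ij b iW jW]]]|none] :=
      boolP [exists i, exists j, [&& i != j, bad i j, i \notin W & j \notin W]].
    left; exists ((i, j) :: ps); split => /=.
    + by rewrite sz.
    + have /andP[i1 i2] : (i \notin map fst ps) && (i \notin map snd ps).
        by move: iW; rewrite inE mem_cat negb_or.
      have /andP[j1 j2] : (j \notin map fst ps) && (j \notin map snd ps).
        by move: jW; rewrite inE mem_cat negb_or.
      rewrite mem_cat negb_or i1 /= inE negb_or ij i2 /=.
      by rewrite -cat1s uniq_catCA /= mem_cat negb_or j1 j2.
    + by move=> p; rewrite inE => /orP[/eqP->//|/al].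
  right; exists W.
    rewrite cardsE; apply: leq_trans (card_size _) _.
    by rewrite size_cat !size_map sz; clear; lia.
  move=> i j ij b; move: none; rewrite negb_exists => /forallP/(_ i).
  rewrite negb_exists => /forallP/(_ j); rewrite ij b /= negb_and !negbK.
  by [].
- by right; exists W => //; apply: leq_trans cW _; clear; lia.
Qed.

End Matching.

(** * Pairs of rows and the event forced by a left null vector *)

Section Unstructured.
Variables (R : realType) (n d : nat) (w : R[i]).
Implicit Types (pi : perms n d) (x u v : 'I_n -> R[i]) (rho tau : R).

Definition rrow x pi i : R[i] := \sum_l x (pi l i) - w * x i.

Lemma rrow_inv x pi i : rrow x pi i = lrow w x (inv_perms pi) i.
Proof.
by congr (_ - _); apply: eq_bigr => l _; rewrite ffunE invgK.
Qed.

(** The bilinear form of [S - w I] at [v] and [u], computed by rows and by columns. *)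
Lemma pairing u v pi :
  \sum_i v i * rrow u pi i = \sum_j u j * lrow w v pi j.
Proof.
rewrite /rrow /lrow /colsum.
under eq_bigr do rewrite mulrBr mulr_sumr.
under [RHS]eq_bigr do rewrite mulrBr mulr_sumr.
rewrite !sumrB; congr (_ - _); last by apply: eq_bigr => i _; ring.
rewrite exchange_big [RHS]exchange_big /=; apply: eq_bigr => l _.
rewrite [RHS](reindex_inj (@perm_inj _ (pi l))) /=.
by apply: eq_bigr => i _; rewrite permK mulrC.
Qed.

Definition hits rho u pi i j :=
  #|[set l | rho <= cabs (u (pi l i) - u (pi l j))]|.

(** Union bound over a grid for [u] and over the [k] pairs. Rounding changes differences of entries
    by at most [rho / 4], so the threshold [rho / 2] for grid values fits between [rho] in the
    degrees and [rho / 4] in the hits. *)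
Lemma uprob_matching rho (N m k H : nat) :
  (0 < n)%N -> (0 < N)%N -> 2 / N%:R <= rho / 8 -> (4 * k <= m)%N ->
  (m <= n)%N ->
  uprob R (fun pi => exists u, [/\ forall j, cabs (u j) <= 1,
      forall b, (m <= deg rho u b)%N &
      exists a b : 'I_k -> 'I_n, [/\ injective a, injective b,
        forall s t, a s != b t &
        forall s, (hits (rho / 4) u pi (a s) (b s) < H)%N]])
  <= (((2 * N).+1 ^ 2) ^ n * n ^ k * n ^ k)%:R *
     (2 ^+ (k * H) * (1 - m%:R / (4 * n%:R)) ^+ (d * k)).
Proof.
move=> n0 N0 Nrho km mn.
pose I := ({ffun 'I_n -> grid N} * {ffun 'I_k -> 'I_n} * {ffun 'I_k -> 'I_n})%type.
have -> : (((2 * N).+1 ^ 2) ^ n * n ^ k * n ^ k)%N = #|{: I}|.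
  by rewrite !card_prod !card_ffun card_grid !card_ord.
pose Q (g : {ffun 'I_n -> grid N}) : rel 'I_n := fun i j =>
  rho / 2 < cabs (grid_val R (g i) - grid_val R (g j)).
pose ok (c : I) pi := [/\ injective c.1.2, injective c.2,
    forall s t, c.1.2 s != c.2 t,
    forall i, (m <= #|[set j | Q c.1.1 i j]|)%N &
    forall s, (#|[set l | Q c.1.1 (pi l (c.1.2 s)) (pi l (c.2 s))]| < H)%N].
apply: (@le_trans _ _ (uprob R (fun pi => exists c, ok c pi))); last first.
  apply: uprob_exists_le => -[[g a] b]; rewrite /ok /=.
  have [[inja injb ab degQ]|none] := pselect ([/\ injective a, injective b,
    forall s t, a s != b t & forall i, (m <= #|[set j | Q g i j]|)%N]).
    apply: uprob_card_le (card_few_hits_le d inja injb ab R n0 degQ km H).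
    by move=> pi [_ _ _ _ h]; rewrite inE; apply/forallP.
  apply: uprob_le_const => [pi [h1 h2 h3 h4 _]|]; first by apply: none.
  have mn' : m%:R <= 4 * n%:R :> R.
    by rewrite -natrM ler_nat; move: mn; clear; lia.
  rewrite mulr_ge0 ?exprn_ge0 // subr_ge0 ler_pdivrMr ?mul1r //.
  by rewrite mulr_gt0 // ltr0n.
apply: uprob_le => pi [u [u1 degu [a [b [inja injb ab few]]]]].
have [g gP] := fin_all_exists (fun j => gridP N0 (u1 j)).
have close i j : cabs (u i - u j) <=
    cabs (grid_val R (g i) - grid_val R (g j)) + rho / 4.
  have := cabs_tri (grid_val R (g i)) (u i) (u j).
  have := cabs_tri (grid_val R (g j)) (grid_val R (g i)) (u j).
  rewrite [cabs (grid_val R (g j) - u j)]cabsBC.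
  by have := gP i; have := gP j; lra.
have close' i j : cabs (grid_val R (g i) - grid_val R (g j)) <=
    cabs (u i - u j) + rho / 4.
  have := cabs_tri (u i) (grid_val R (g i)) (grid_val R (g j)).
  have := cabs_tri (u j) (u i) (grid_val R (g j)).
  rewrite [cabs (grid_val R (g i) - u i)]cabsBC.
  by have := gP i; have := gP j; lra.
have rho0 : 0 < rho.
  by have : 0 < 2 / N%:R :> R by [rewrite divr_gt0 // ltr0n]; lra.
exists (finfun g, finfun a, finfun b); split => /=.
- by move=> s t; rewrite !ffunE => /inja.
- by move=> s t; rewrite !ffunE => /injb.
- by move=> s t; rewrite !ffunE.
- move=> i; apply: leq_trans (degu i) _.
  apply/subset_leq_card/fintype.subsetP => j; rewrite !inE /Q !ffunE cabsBC.
  by have := close i j; lra.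
- move=> s; apply: leq_ltn_trans (few s).
  apply/subset_leq_card/fintype.subsetP => l; rewrite !inE /Q !ffunE.
  by have := close' (pi l (a s)) (pi l (b s)); lra.
Qed.

Section PairEvent.
Variables (rho delta tau : R) (H p : nat).
Hypotheses (rho0 : 0 < rho) (tau0 : 0 <= tau).
Hypothesis small : 4 * ((2 * n + 2)%:R * tau) < delta * rho.
Hypothesis pH : (4 * p <= H)%N.

Definition pair_event (i j : 'I_n) pi := exists u v,
  [/\ forall k, cabs (u k) <= 1, forall k, cabs (rrow u pi k) <= tau,
      near_null w v pi tau, rho < cabs (v i - v j) &
      (H <= hits delta u pi i j)%N].

Lemma swapsE i j (A : {set 'I_d}) pi l k :
  swaps i j A pi l k = pi l (if l \in A then tperm i j k else k).
Proof. by rewrite ffunE; case: (l \in A) => //; rewrite permM. Qed.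

Lemma hits_swaps i j A u pi :
  hits delta u (swaps i j A pi) i j = hits delta u pi i j.
Proof.
apply: eq_card => l; rewrite !inE !swapsE.
by case: (l \in A); rewrite // tpermL tpermR cabsBC.
Qed.

Lemma rrow_swaps i j A u pi k : k != i -> k != j ->
  rrow u (swaps i j A pi) k = rrow u pi k.
Proof.
move=> ki kj; congr (_ - _); apply: eq_bigr => l _; rewrite swapsE.
by case: ifP => // _; rewrite tpermD // eq_sym.
Qed.

Lemma rrow_swaps_add i j A u pi :
  rrow u (swaps i j A pi) i + rrow u (swaps i j A pi) j =
  rrow u pi i + rrow u pi j.
Proof.
rewrite /rrow addrACA [RHS]addrACA; congr (_ + _).
rewrite -!big_split /=; apply: eq_bigr => l _; rewrite !swapsE.
by case: ifP => // _; rewrite tpermL tpermR addrC.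
Qed.

Lemma rrow_swapsE i j A u pi : rrow u (swaps i j A pi) i =
  \sum_(l in A) (u (pi l j) - u (pi l i)) - (w * u i - \sum_l u (pi l i)).
Proof.
rewrite /rrow [X in X - (_ - _)]big_mkcond /= opprB addrA -big_split /=.
congr (_ - _); apply: eq_bigr => l _; rewrite swapsE.
by case: ifP => _; rewrite ?tpermL ?subrK ?add0r.
Qed.

(** With [pi] frozen, one [u] serves all the sets [A] of swaps: the rows other than [i], [j] and the
    sum of these two do not depend on [A]. Pairing with a near-null [v] for [A] then makes row [i]
    tiny, and this row is a subset sum over [A]. *)
Lemma uprob_pair_event i j : i != j ->
  uprob R (pair_event i j) <= 'C(2 * p, p)%:R / 4 ^+ p.
Proof.
move=> ij; apply: (@uprob_swaps_le _ _ _ i j) => pi.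
set S := finset _.
(* [u] is taken from a single [A0] in the event; every other [A] contributes only its own [v]. *)
have [->|[A0]] := set_0Vmem S.
  by rewrite cards0 mulr_ge0 ?divr_ge0 ?exprn_ge0.
rewrite !inE => -[u [_ [u1 ut _ _ hu]]].
have p4 : 0 < 4 ^+ p :> R by rewrite exprn_gt0.
rewrite mulrAC ler_pdivlMr // mulrC [X in _ <= X]mulrC -!natrX -!natrM ler_nat mulnC.
pose a l := u (pi l j) - u (pi l i).
pose s := w * u i - \sum_l u (pi l i).
have cS : (4 * p <= #|[set l | (delta <= cabs (a l))%R]|)%N.
  apply: leq_trans pH _; apply: leq_trans hu _; rewrite hits_swaps.
  by apply/subset_leq_card/fintype.subsetP => l; rewrite !inE /a cabsBC.
have rd : 4 * ((2 * n + 2)%:R * tau / rho) < delta.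
  by rewrite mulrA ltr_pdivrMr.
apply: leq_trans (littlewood_offord s cS rd).
rewrite leq_mul2r; apply/orP; right.
apply/subset_leq_card/fintype.subsetP => A; rewrite !inE.
move=> [_ [v [_ _ [v1 vt] vij _]]].
rewrite -rrow_swapsE ler_pdivlMr //.
set pi' := swaps i j A pi in vt *.
have := pairing u v pi'.
rewrite (bigD1 i) //= (bigD1 j) //=; last by rewrite eq_sym.
set rest := \sum_(k | _) _; set tot := \sum_k _ => e.
have hrest : cabs rest <= n%:R * tau.
  apply: le_trans (cabs_sum _ _ _) _.
  apply: (@le_trans _ _ (\sum_(k < n) tau)); last first.
    by rewrite sumr_const card_ord mulr_natl.
  rewrite big_mkcond /=; apply: ler_sum => k _; case: ifP => // /andP[ki kj].
  rewrite cabsM -[X in _ <= X]mul1r; apply: ler_pM => //; rewrite ?cabs_ge0 //.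
  have := ut k; rewrite rrow_swaps //.
  by rewrite /pi' rrow_swaps.
have htot : cabs tot <= n%:R * tau.
  rewrite -[X in X%:R * _](card_ord n); apply: cabs_sum_le => k.
  rewrite cabsM -[X in _ <= X]mul1r; apply: ler_pM => //; rewrite ?cabs_ge0 //.
have hadd : cabs (rrow u pi' i + rrow u pi' j) <= 2 * tau.
  rewrite /pi' rrow_swaps_add -(rrow_swaps_add i j A0).
  by apply: le_trans (cabsD _ _) _; have := ut i; have := ut j; lra.
(* Rows [i] and [j] are regrouped through their sum, already known to be small, so that only row [i]
   remains, with the coefficient [v i - v j] bounded below. *)
have key : (v i - v j) * rrow u pi' i =
    tot - rest - v j * (rrow u pi' i + rrow u pi' j).
  by rewrite -e; ring.
have := congr1 (@cabs R) key; rewrite cabsM => k1.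
have k2 : cabs (v j * (rrow u pi' i + rrow u pi' j)) <= 2 * tau.
  by rewrite cabsM -[X in _ <= X]mul1r; apply: ler_pM => //; rewrite ?cabs_ge0.
have k3 := cabsB (tot - rest) (v j * (rrow u pi' i + rrow u pi' j)).
have k4 := cabsB tot rest.
have k5 : rho * cabs (rrow u pi' i) <= cabs (v i - v j) * cabs (rrow u pi' i).
  by rewrite ler_wpM2r ?cabs_ge0 // ltW.
rewrite mulrC natrD natrM mulrDl -mulrA.
move: k1 k2 k3 k4 k5 hrest htot.
move: (cabs (v i - v j) * _) (cabs (tot - rest - _)) (cabs (v j * _)) (cabs tot)
  (cabs rest) (cabs (tot - rest)) (n%:R * tau) (rho * _).
by clear; move=> *; lra.
Qed.

End PairEvent.

End Unstructured.

(** * Assembling the events *)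

Section Combination.
Variables (R : realType) (n d : nat) (w : R[i]).
Variables (P tau : R) (K q mx N k H p : nat) (c : R).
Hypotheses (d0 : (0 < d)%N) (n0 : (0 < n)%N) (P16 : 16 * d%:R <= P).
Hypotheses (q0 : (0 < q)%N) (qK : (n <= q ^ K)%N) (mxn : (2 * mx <= n)%N).
Hypothesis wd : cabs w <= d%:R / 2.
Hypothesis tau0 : 0 <= tau.
Hypothesis tauK : tau <= d%:R * scale P K.
Hypotheses (N0 : (0 < N)%N) (NK : 2 / N%:R <= scale P K / 8).
Hypothesis cm : forall m, (m < mx)%N ->
    ((n * (2 * N).+1 ^ 2) ^ m * (2 * N).+1 ^ 2)%:R *
      (3 / 4) ^+ minn (d * (m %/ q).+1) (n %/ 10) <= c.
Hypothesis kmx : (4 * k < mx)%N.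
Hypothesis tau_small : 4 * ((2 * n + 2)%:R * tau) < scale P K / 4 * scale P K.
Hypothesis pH : (4 * p <= H)%N.

Definition rnull (pi : perms n d) := exists u : 'I_n -> R[i],
  [/\ exists i, 1 <= cabs (u i), forall j, cabs (u j) <= 1 & forall i, cabs (rrow w u pi i) <= tau].

Definition lnull (pi : perms n d) := exists v : 'I_n -> R[i],
  (exists i, 1 <= cabs (v i)) /\ near_null w v pi tau.

(** The first term pays for a structured null vector on the left or on the right, the second for [k]
    disjoint pairs with few hits. Otherwise at least [n * (mx - 4 * k)] ordered pairs satisfy
    [pair_event], and Markov's inequality over the [n ^ 2] pairs gives the third. *)
Lemma uprob_near_null :
  uprob R (fun pi : perms n d => rnull pi /\ lnull pi) <=
    2 * ((K * mx)%:R * c) +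
    (((2 * N).+1 ^ 2) ^ n * n ^ k * n ^ k)%:R *
     (2 ^+ (k * H) * (1 - mx%:R / (4 * n%:R)) ^+ (d * k)) +
    n%:R * ('C(2 * p, p)%:R / 4 ^+ p) / (mx - 4 * k)%:R.
Proof.
set rho := scale P K.
have rho0 : 0 < rho by apply: (scale_gt0 (d := d)).
have NK' : 2 / N%:R <= scale P K by apply: le_trans NK _; rewrite -/rho; lra.
pose SL (pi : perms n d) := exists x, [/\ exists i, 1 <= cabs (x i),
     near_null w x pi tau & exists b, (deg rho x b < mx)%N].
pose SR pi := SL (inv_perms pi).
pose G (pi : perms n d) := exists u : 'I_n -> R[i], [/\ forall j, cabs (u j) <= 1,
      forall b, (mx <= deg rho u b)%N &
      exists a b : 'I_k -> 'I_n, [/\ injective a, injective b,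
        forall s t, a s != b t &
        forall s, (hits (rho / 4) u pi (a s) (b s) < H)%N]].
pose ev := @pair_event R n d w rho (rho / 4) tau H.
pose Good (pi : perms n d) :=
  (n * (mx - 4 * k) <= #|[set e : 'I_n * 'I_n | `[< ev e.1 e.2 pi >]]|)%N.
have hSL : uprob R SL <= (K * mx)%:R * c.
  refine (uprob_structured d0 P16 q0 qK mxn wd tauK N0 NK' cm).
have hSR : uprob R SR <= (K * mx)%:R * c by rewrite /SR uprob_inv.
have hG : uprob R G <= (((2 * N).+1 ^ 2) ^ n * n ^ k * n ^ k)%:R *
     (2 ^+ (k * H) * (1 - mx%:R / (4 * n%:R)) ^+ (d * k)).
  apply: uprob_matching => //; first by move: kmx; clear; lia.
  by move: mxn; clear; lia.
have cpos : 0 <= 'C(2 * p, p)%:R / 4 ^+ p :> R.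
  by rewrite divr_ge0 // exprn_ge0.
have hE e : uprob R (ev e.1 e.2) <= 'C(2 * p, p)%:R / 4 ^+ p.
  case: (eqVneq e.1 e.2) => [->|ne]; last first.
    exact: uprob_pair_event.
  apply: uprob_le_const => // pi [u [v [_ _ _ + _]]].
  by rewrite subrr cabs0 ltNge ltW.
have hGood : uprob R Good <= n%:R * ('C(2 * p, p)%:R / 4 ^+ p) / (mx - 4 * k)%:R.
  have m0 : 0 < (mx - 4 * k)%:R :> R by rewrite ltr0n subn_gt0.
  have nR : 0 < n%:R :> R by rewrite ltr0n.
  rewrite ler_pdivlMr // -(ler_pM2l nR) [uprob _ _ * _]mulrC [X in X <= _]mulrA -natrM.
  apply: le_trans (@uprob_count R n d _ (fun pi => is_true (Good pi))
     (fun e : 'I_n * 'I_n => ev e.1 e.2)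
     (n * (mx - 4 * k)) (fun pi h => h)) _.
  apply: le_trans (ler_sum _ (fun e _ => hE e)) _.
  by rewrite sumr_const card_prod card_ord -[X in X <= _]mulr_natl natrM -mulrA.
suff sub : uprob R (fun pi : perms n d => rnull pi /\ lnull pi) <=
    uprob R (fun pi => (SL pi \/ SR pi) \/ (G pi \/ Good pi)).
  apply: le_trans sub _; apply: le_trans (uprob_or _ _ _) _.
  have := uprob_or R SL SR; have := uprob_or R G Good.
  by move: hSL hSR hG hGood; lra.
apply: uprob_le => pi [[u [ui u1 ut]] [v [vi vn]]].
have [sl|nsl] := pselect (SL pi); first by left; left.
have [sr|nsr] := pselect (SR pi); first by left; right.
right; have [g|ng] := pselect (G pi); [by left|right].
have degv b : (mx <= deg rho v b)%N.
  rewrite leqNgt; apply/negP => h; apply: nsl.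
  by exists v; split => //; exists b.
have degu b : (mx <= deg rho u b)%N.
  rewrite leqNgt; apply/negP => h; apply: nsr; exists u; split => //.
    by split => // j; rewrite -rrow_inv.
  by exists b.
pose bad : rel 'I_n := fun i j => (hits (rho / 4) u pi i j < H)%N.
have [mat|few] := matching_or_cover bad k.
  by case: ng; exists u; split.
pose V := [set e : 'I_n * 'I_n | rho < cabs (v e.1 - v e.2)].
have cV : (n * mx <= #|V|)%N.
  have -> : #|V| = (\sum_(j < n) deg rho v j)%N.
    rewrite -sum1dep_card (eq_bigl (fun e : 'I_n * 'I_n =>
      true && (rho < cabs (v e.1 - v e.2)))) // .
    rewrite -(pair_big_dep xpredT (fun i j => rho < cabs (v i - v j))
      (fun _ _ => 1%N)) /=.
    rewrite (exchange_big_dep xpredT) //=; apply: eq_bigr => j _.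
    by rewrite sum1dep_card.
  by rewrite -[X in (X * _)%N](card_ord n) -sum_nat_const; apply: leq_sum.
have sub : V :\: [set e : 'I_n * 'I_n | (e.1 != e.2) && bad e.1 e.2] \subset
    [set e : 'I_n * 'I_n | `[< ev e.1 e.2 pi >]].
  apply/fintype.subsetP => -[i j]; rewrite finset.in_setD => /andP[].
  rewrite !finset.in_set /= => nb vij.
  have ij : i != j.
    by apply: contraTneq vij => ->; rewrite subrr cabs0 -leNgt ltW.
  apply/asboolP; exists u, v; split => //.
  by move: nb; rewrite ij /= /bad -leqNgt.
rewrite /Good; apply: leq_trans (subset_leq_card sub).
rewrite cardsD mulnBr; apply: leq_sub => //.
apply: leq_trans (subset_leq_card (finset.subsetIr _ _)) _.
by apply: leq_trans few _; rewrite mulnC.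
Qed.

End Combination.

(** * Null vectors from a small singular value *)

Section SmallestSingularValue.
Variables (R : realType) (n : nat).
Hypothesis n0 : (0 < n)%N.

Lemma cabs_gt0 (z : R[i]) : z != 0 -> 0 < cabs z.
Proof.
move=> z0; rewrite lt_neqAle cabs_ge0 andbT eq_sym.
by apply: contra z0 => /eqP/cabs0_eq0 ->.
Qed.

Lemma normalize (f : 'I_n -> R[i]) : (exists i, f i != 0) ->
  exists i0, [/\ f i0 != 0, forall j, cabs (f j) <= cabs (f i0) &
                 forall j, cabs (f j / f i0) <= 1].
Proof.
move=> [i fi]; case: (@arg_maxP _ R _ i xpredT (fun j => cabs (f j)) isT) => i0 _ mx0.
have f0 : f i0 != 0.
  apply: contraNneq fi => f0; apply/eqP/cabs0_eq0.
  by apply/eqP; rewrite eq_le cabs_ge0 andbT; have := mx0 i isT; rewrite f0 cabs0.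
have c0 := cabs_gt0 f0.
exists i0; split => // j; first exact: mx0.
by rewrite cabsM cabsV ler_pdivrMr // mul1r; apply: mx0.
Qed.

Lemma vnorm2E m (x : 'cV[R[i]]_m) : vnorm2 x = \sum_k cabs (x k ord0) ^+ 2.
Proof.
by apply: eq_bigr => k _; rewrite sqr_sqrtr // addr_ge0 ?sqr_ge0.
Qed.

Lemma cabs_le_vnorm m (x : 'cV[R[i]]_m) k : cabs (x k ord0) <= vnorm x.
Proof.
rewrite /vnorm vnorm2E -[X in X <= _]ger0_norm ?cabs_ge0 // -sqrtr_sqr.
rewrite ler_wsqrtr // (bigD1 k) //= lerDl sumr_ge0 // => i _.
exact: sqr_ge0.
Qed.

(** The factor [2] avoids proving that the infimum is attained. *)
Lemma smin_witness (M : 'M[R[i]]_n) t : 0 < t -> smin M <= t ->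
  exists2 x : 'cV[R[i]]_n, vnorm x = 1 & vnorm (M *m x) <= 2 * t.
Proof.
move=> t0 Mt.
have hinf : has_inf [set vnorm (M *m x) | x in [set x : 'cV[R[i]]_n | vnorm x = 1]]%classic.
  split.
    exists (vnorm (M *m delta_mx (Ordinal n0) ord0)).
    exists (delta_mx (Ordinal n0) ord0) => //=.
    rewrite /vnorm vnorm2E (bigD1 (Ordinal n0)) //= big1 => [|i ni].
      by rewrite mxE !eqxx /= cabs1 expr1n addr0 sqrtr1.
    by rewrite mxE (negbTE ni) /= cabs0 expr0n.
  by exists 0 => _ [x _ <-]; apply: sqrtr_ge0.
have [_ [x x1 <-] h] := inf_adherent t0 hinf.
exists x => //; apply: ltW; apply: lt_le_trans h _.
by rewrite -/(smin M); lra.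
Qed.

(** On the right, rescale a near-minimizer [x] by its largest entry, at index [i0]. On the left,
    take a kernel vector if [M] is singular, and otherwise row [i0] of the inverse: its product with
    [M] is a unit vector, while [x i0] can be recovered from the tiny [M *m x] only if this row has
    a large entry. *)
Lemma near_null_vectors (M : 'M[R[i]]_n) t : 0 < t -> smin M <= t ->
  (exists u : 'I_n -> R[i], [/\ exists i, 1 <= cabs (u i),
     forall j, cabs (u j) <= 1 &
     forall i, cabs (\sum_j M i j * u j) <= 2 * n%:R ^+ 2 * t]) /\
  (exists v : 'I_n -> R[i], [/\ exists i, 1 <= cabs (v i),
     forall j, cabs (v j) <= 1 &
     forall j, cabs (\sum_i v i * M i j) <= 2 * n%:R ^+ 2 * t]).
Proof.
move=> t0 /(smin_witness t0)[x x1 Mx].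
have nR : 1 <= n%:R :> R by rewrite ler1n.
have xne : exists i, x i ord0 != 0.
  apply: contrapT => none; move: x1; rewrite /vnorm vnorm2E big1.
    by rewrite sqrtr0 => /eqP; rewrite eq_sym oner_eq0.
  move=> i _; case: (eqVneq (x i ord0) 0) => [->|h].
    by rewrite cabs0 expr0n.
  by case: none; exists i.
have [i0 [xi0 xmax xle]] := normalize xne.
have c0 := cabs_gt0 xi0.
have cn : 1 <= n%:R * cabs (x i0 ord0).
  have : 1 <= n%:R * cabs (x i0 ord0) ^+ 2.
    have e1 : vnorm2 x = 1.
      by rewrite -(sqr_sqrtr (a := vnorm2 x)) -/(vnorm x) ?x1 ?expr1n //
        vnorm2E sumr_ge0 // => i _; apply: sqr_ge0.
    rewrite -[X in X <= _]e1 vnorm2E mulr_natl -[X in _ *+ X](card_ord n) -sumr_const.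
    by apply: ler_sum => k _; rewrite ler_pXn2r ?nnegrE ?cabs_ge0.
  have := cabs_le_vnorm x i0; rewrite x1 => c1 h; apply: le_trans h _.
  by rewrite ler_pM2l ?(lt_le_trans ltr01 nR) // expr2 ler_piMl // cabs_ge0.
split.
  exists (fun j => x j ord0 / x i0 ord0); split => //.
    by exists i0; rewrite divff // cabs1.
  move=> i.
  have -> : \sum_j M i j * (x j ord0 / x i0 ord0) = (M *m x) i ord0 / x i0 ord0.
    by rewrite mxE mulr_suml; apply: eq_bigr => j _; rewrite mulrA.
  rewrite cabsM cabsV ler_pdivrMr //.
  apply: le_trans (cabs_le_vnorm _ _) _; apply: le_trans Mx _.
  set y := cabs _ in cn *.
  have -> : 2 * n%:R ^+ 2 * t * y = 2 * t * (n%:R * (n%:R * y)) by ring.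
  by apply: ler_peMr; [lra|apply: mulr_ege1].
have [inv|] := boolP (M \in unitmx); last first.
  rewrite unitmxE unitfE negbK => /det0P[v vne vM].
  have /normalize[k0 [vk0 _ vle]] : exists i, v ord0 i != 0.
    by case/rV0Pn: vne => i vi; exists i.
  exists (fun i => v ord0 i / v ord0 k0); split => //.
    by exists k0; rewrite divff // cabs1.
  move=> j.
  have -> : \sum_i v ord0 i / v ord0 k0 * M i j = (v *m M) ord0 j / v ord0 k0.
    by rewrite mxE mulr_suml; apply: eq_bigr => i _; rewrite mulrAC.
  by rewrite vM mxE mul0r cabs0 !mulr_ge0 ?exprn_ge0 // ltW.
pose f k := invmx M i0 k.
have xE : x i0 ord0 = \sum_k f k * (M *m x) k ord0.
  by rewrite -[x in LHS]mul1mx -(mulVmx inv) -mulmxA mxE.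
have fne : exists i, f i != 0.
  apply: contrapT => none; move/eqP: xi0; apply; rewrite xE big1 // => k _.
  by case: (eqVneq (f k) 0) => [->|h]; [rewrite mul0r|case: none; exists k].
have [k0 [fk0 fmax fle]] := normalize fne.
have cf := cabs_gt0 fk0.
have hx : cabs (x i0 ord0) <= n%:R * (cabs (f k0) * (2 * t)).
  rewrite xE -[X in X%:R * _](card_ord n); apply: cabs_sum_le => k.
  rewrite cabsM; apply: ler_pM; rewrite ?cabs_ge0 //.
  exact: le_trans (cabs_le_vnorm _ _) Mx.
exists (fun i => f i / f k0); split => //.
  by exists k0; rewrite divff // cabs1.
move=> j.
have -> : \sum_i f i / f k0 * M i j = (i0 == j)%:R / f k0.
  transitivity ((invmx M *m M) i0 j / f k0); last by rewrite mulVmx // mxE.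
  by rewrite mxE mulr_suml; apply: eq_bigr => i _; rewrite mulrAC.
rewrite cabsM cabsV cabs_nat ler_pdivrMr //.
apply: (@le_trans _ _ 1); first by case: (i0 == j).
apply: le_trans cn _.
have h := ler_wpM2l (ler0n R n) hx; apply: le_trans h _.
by rewrite le_eqVlt; apply/orP; left; apply/eqP; ring.
Qed.

End SmallestSingularValue.

(** * Choice of parameters *)

Section ShiftedMatrix.
Variables (R : realType) (n d : nat) (z : R[i]) (pi : perms n d).
Hypothesis d0 : (0 < d)%N.
Let rd : R := Num.sqrt d%:R.
Let w : R[i] := rd%:C * z.

Lemma rd_gt0 : 0 < rd.
Proof. by rewrite sqrtr_gt0 ltr0n. Qed.

Lemma shifted_matrixE i j : shifted_matrix z pi i j =
  (rd^-1)%:C * (\sum_l (pi l i == j)%:R) - z *+ (i == j).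
Proof. by rewrite !mxE. Qed.

Lemma rd_unit : (rd^-1)%:C * (rd%:C * z) = z.
Proof.
by rewrite mulrA -rmorphM /= mulVf ?gt_eqF ?rd_gt0 // mul1r.
Qed.

Lemma shifted_matrix_rrow (u : 'I_n -> R[i]) i :
  \sum_j shifted_matrix z pi i j * u j = (rd^-1)%:C * rrow w u pi i.
Proof.
have s1 : \sum_j (\sum_l ((pi l i == j)%:R : R[i])) * u j = \sum_l u (pi l i).
  under eq_bigr do rewrite mulr_suml.
  rewrite exchange_big /=; apply: eq_bigr => l _.
  rewrite (bigD1 (pi l i)) //= eqxx mul1r big1 ?addr0 // => j ji.
  by rewrite eq_sym (negbTE ji) mul0r.
have s2 : \sum_j z *+ (i == j) * u j = z * u i.
  rewrite (bigD1 i) //= eqxx mulr1n big1 ?addr0 // => j ji.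
  by rewrite eq_sym (negbTE ji) mulr0n mul0r.
under eq_bigr do rewrite shifted_matrixE mulrBl -mulrA.
rewrite sumrB s2 -mulr_sumr s1 /rrow mulrBr; congr (_ - _).
by rewrite mulrA /w rd_unit.
Qed.

Lemma shifted_matrix_lrow (v : 'I_n -> R[i]) j :
  \sum_i v i * shifted_matrix z pi i j = (rd^-1)%:C * lrow w v pi j.
Proof.
have s1 : \sum_i v i * (\sum_l ((pi l i == j)%:R : R[i])) = colsum v pi j.
  under eq_bigr do rewrite mulr_sumr.
  rewrite exchange_big /=; apply: eq_bigr => l _.
  rewrite (bigD1 ((pi l)^-1%g j)) //= permKV eqxx mulr1 big1 ?addr0 // => i ij.
  have [e|_] := eqVneq (pi l i) j; last by rewrite mulr0.
  by move: ij; rewrite -e permK eqxx.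
have s2 : \sum_i v i * (z *+ (i == j)) = z * v j.
  rewrite (bigD1 j) //= eqxx mulr1n mulrC big1 ?addr0 // => i ij.
  by rewrite (negbTE ij) mulr0n mulr0.
under eq_bigr do rewrite shifted_matrixE mulrBr mulrCA.
rewrite sumrB s2 -mulr_sumr s1 /lrow mulrBr; congr (_ - _).
by rewrite mulrA /w rd_unit.
Qed.

Lemma smin_near_null t : (0 < n)%N -> 0 < t -> smin (shifted_matrix z pi) <= t ->
  rnull w (rd * (2 * n%:R ^+ 2 * t)) pi /\ lnull w (rd * (2 * n%:R ^+ 2 * t)) pi.
Proof.
move=> n0 t0 /(near_null_vectors n0 t0)[[u [ui u1 ut]] [v [vi v1 vt]]].
have rp := rd_gt0.
have cr y : cabs ((rd^-1)%:C * y) = rd^-1 * cabs y.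
  by rewrite cabsM cabsR ger0_norm // invr_ge0 ltW.
split; [exists u|exists v]; split => //.
  move=> i; have := ut i; rewrite shifted_matrix_rrow cr.
  by rewrite ler_pdivrMl.
split => // j; have := vt j; rewrite shifted_matrix_lrow cr.
by rewrite ler_pdivrMl.
Qed.

End ShiftedMatrix.

(** * Integer parameters and their inequalities *)

Section ChosenSizes.
Variables (n d lg A : nat).
Local Notation D := (minn d n).
Hypotheses (n2 : (2 <= n)%N) (lg0 : (0 < lg)%N) (nlg : (n <= 2 ^ lg)%N).
Hypotheses (A_lg : (2000 * lg ^ 2 <= A)%N) (hD : (324 * A ^ 4 <= D)%N).

Lemma lg_sq : (lg <= lg ^ 2)%N.
Proof. by rewrite -mulnn leq_pmulr. Qed.

Lemma A_ge : (2000 <= A)%N.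
Proof.
by apply: leq_trans A_lg; rewrite leq_pmulr // expn_gt0 lg0.
Qed.

Lemma A_gt0 : (0 < A)%N.
Proof. exact: leq_trans A_ge. Qed.

Lemma D_ge j : (j <= 4)%N -> (324 * A ^ j <= D)%N.
Proof.
move=> j4; apply: leq_trans hD; rewrite leq_mul2l; apply/orP; right.
by rewrite leq_exp2l // (leq_trans _ A_ge).
Qed.

(* With [A] of order [log^2 n]: [par_q] is the growth factor of the degree
   between two consecutive scales, [par_K] the number of scales, [par_mx] the
   degree reached at the last one, [par_k] the size of the matchings excluded by
   the union bound, [par_H] the number of hits required of a good pair, [par_p]
   the number of swaps fed to Littlewood-Offord and [par_N] the grid size. *)
Definition par_q := (D %/ A)%N.
Definition par_K := up_log par_q n.
Definition par_mx := (n %/ (10 * A))%N.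
Definition par_k := ((A ^ 3 * n) %/ D).+1.
Definition par_H := ((d * par_mx) %/ (8 * n))%N.
Definition par_p := (par_H %/ 4)%N.
Definition par_N := (16 * (n ^ 110) ^ par_K.+1)%N.

Lemma q_le : (par_q * A <= D)%N.
Proof. exact: leq_trunc_div. Qed.

Lemma q_gt1 : (1 < par_q)%N.
Proof.
rewrite leq_divRL ?A_gt0 //; apply: leq_trans (@D_ge 1 _) => //.
by rewrite expn1 leq_mul2r orbT.
Qed.

(** As [4 * A ^ 2 <= D], dividing [D] by [A] costs at most a square root; the number of scales
    therefore stays of order [log n / log D]. *)
Lemma D_le_q2 : (D <= par_q ^ 2)%N.
Proof.
have h1 : (D < 2 * par_q * A)%N.
  apply: (@leq_trans (par_q.+1 * A)); first by rewrite ltn_ceil ?A_gt0.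
  by rewrite leq_mul2r; apply/orP; right; have := q_gt1; clear; lia.
have h2 : (4 * A ^ 2 <= D)%N.
  by apply: leq_trans (@D_ge 2 _) => //; rewrite leq_mul2r orbT.
have h3 : (0 < 4 * A ^ 2)%N by rewrite muln_gt0 expn_gt0 A_gt0.
rewrite -(leq_pmul2r h3).
apply: (@leq_trans (D * D)); first by rewrite leq_mul2l h2 orbT.
have -> : (par_q ^ 2 * (4 * A ^ 2) = (2 * par_q * A) * (2 * par_q * A))%N by ring.
by apply: leq_mul; apply: ltnW.
Qed.

Lemma n_le_qK : (n <= par_q ^ par_K)%N.
Proof. exact: up_logP q_gt1. Qed.

Lemma K_le_lg : (par_K <= lg)%N.
Proof.
apply: up_log_min; first exact: q_gt1.
by apply: leq_trans nlg _; rewrite leq_exp2r // q_gt1.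
Qed.

Lemma D_le_n : (D <= n)%N. Proof. exact: geq_minr. Qed.
Lemma D_le_d : (D <= d)%N. Proof. exact: geq_minl. Qed.

Lemma mx_le : (par_mx * (10 * A) <= n)%N.
Proof. exact: leq_trunc_div. Qed.

Lemma mx_gt0 : (0 < par_mx)%N.
Proof.
rewrite divn_gt0 ?muln_gt0 ?A_gt0 //; apply: leq_trans D_le_n.
by apply: leq_trans (@D_ge 1 _) => //; rewrite expn1 leq_mul2r orbT.
Qed.

Lemma n_le_mx : (n <= par_mx * (20 * A))%N.
Proof.
have : (n < par_mx.+1 * (10 * A))%N by rewrite ltn_ceil // muln_gt0 A_gt0.
move/ltnW/leq_trans; apply.
have -> : (par_mx * (20 * A) = par_mx * 2 * (10 * A))%N by ring.
rewrite leq_mul2r; apply/orP; right; have := mx_gt0; clear; lia.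
Qed.

Lemma mx2_le : (2 * par_mx <= n)%N.
Proof.
apply: leq_trans mx_le; rewrite mulnC leq_mul2l; apply/orP; right.
by have := A_gt0; clear; lia.
Qed.

Lemma mx_n10 : (par_mx * A <= n %/ 10)%N.
Proof.
by rewrite leq_divRL //; apply: leq_trans mx_le; rewrite -mulnA [(A * 10)%N]mulnC.
Qed.

Lemma k_ge : (A ^ 3 * n <= par_k * D)%N.
Proof.
apply: ltnW; rewrite /par_k ltn_ceil //.
by apply: leq_trans (@D_ge 0 _).
Qed.

(** The fourth power in [hD] is needed here: [par_k] is about [A ^ 3 * n / D], at most
    [n / (324 * A)], against [par_mx >= n / (20 * A)]. *)
Lemma k_le_mx : (8 * par_k <= par_mx)%N.
Proof.
have A20 : (0 < 20 * A)%N by rewrite muln_gt0 A_gt0.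
rewrite -(leq_pmul2r A20); apply: leq_trans n_le_mx.
have D0 : (0 < 2 * D)%N by rewrite muln_gt0 /=; apply: leq_trans (@D_ge 0 _).
rewrite -(leq_pmul2r D0) /par_k; set k' := (_ %/ _)%N.
have h1 : (k' * D <= A ^ 3 * n)%N by exact: leq_trunc_div.
have h2 : (324 * A ^ 4 <= D)%N := hD.
have h3 : (324 * A <= n)%N.
  by apply: leq_trans D_le_n; have := @D_ge 1 isT; rewrite expn1.
have -> : (8 * k'.+1 * (20 * A) * (2 * D) =
  (k' * D) * (320 * A) + (320 * A) * D)%N by rewrite -addn1; ring.
have -> : (n * (2 * D) = n * D + n * D)%N by ring.
apply: leq_add; last first.
  by rewrite leq_mul2r; apply/orP; right; move: h3; clear; lia.
apply: (@leq_trans (A ^ 3 * n * (320 * A))); first by rewrite leq_mul2r h1 orbT.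
have -> : (A ^ 3 * n * (320 * A) = n * (320 * A ^ 4))%N by ring.
rewrite leq_mul2l; apply/orP; right; apply: leq_trans h2.
by rewrite leq_mul2r orbT.
Qed.

(** With [A >= 4 * par_a], this many swaps beat the [2 ^ (par_a * m.+1)] points of the net at degree
    [m]. *)
Lemma T_ge m : (m < par_mx)%N ->
  (A * m.+1 <= minn (d * (m %/ par_q).+1) (n %/ 10))%N.
Proof.
move=> mmx; rewrite leq_min; apply/andP; split; last first.
  by apply: leq_trans mx_n10; rewrite mulnC leq_mul2r mmx orbT.
apply: (@leq_trans (par_q * A * (m %/ par_q).+1)); last first.
  by rewrite leq_mul2r (leq_trans q_le D_le_d) orbT.
have : (m < (m %/ par_q).+1 * par_q)%N by rewrite ltn_ceil // (ltn_trans _ q_gt1).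
move=> h; rewrite [(par_q * A)%N]mulnC -mulnA leq_mul2l; apply/orP; right.
by rewrite mulnC.
Qed.

(* The grid, times [n], has at most [2 ^ par_a] points. *)
Definition par_a := (500 * lg ^ 2)%N.

(** The grid step is a power of [n] of order [par_K], and [par_K <= lg], so a grid point costs a
    number of bits of order [lg ^ 2]. *)
Lemma grid_le : ((2 * par_N).+1 ^ 2 * n <= 2 ^ par_a)%N.
Proof.
set X := ((n ^ 110) ^ par_K.+1)%N.
have X0 : (0 < X)%N by rewrite !expn_gt0 (leq_trans _ n2).
have h1 : ((2 * par_N).+1 <= 2 ^ 6 * X)%N.
  rewrite /par_N -/X; move: X0; clear; move: X => X.
  by rewrite (_ : (2 ^ 6)%N = 64) //; lia.
have h2 : (X <= 2 ^ (lg * (110 * par_K.+1)))%N.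
  by rewrite /X -expnM [(2 ^ _)%N]expnM leq_exp2r // muln_gt0.
have h3 : ((2 * par_N).+1 <= 2 ^ (6 + lg * (110 * par_K.+1)))%N.
  by apply: leq_trans h1 _; rewrite expnD leq_mul2l h2 orbT.
apply: (@leq_trans ((2 ^ (6 + lg * (110 * par_K.+1))) ^ 2 * 2 ^ lg)).
  by apply: leq_mul nlg; rewrite leq_exp2r.
rewrite -expnM -expnD leq_exp2l // /par_a.
have := K_le_lg; move: lg0; clear.
move: par_K => K l0 Kl.
have : (lg * K <= lg * lg)%N by rewrite leq_mul2l Kl orbT.
have : (lg <= lg * lg)%N by rewrite leq_pmulr.
rewrite -mulnn; set y := (lg * lg)%N => h1 h2.
have -> : ((6 + lg * (110 * K.+1)) * 2 + lg = 12 + 221 * lg + 220 * (lg * K))%N.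
  by rewrite -[K.+1]addn1; ring.
lia.
Qed.

Lemma a_le_A : (4 * par_a <= A)%N.
Proof. by apply: leq_trans A_lg; rewrite /par_a mulnA. Qed.

Lemma lg_le_a : (lg <= par_a)%N.
Proof. by apply: leq_trans lg_sq _; rewrite leq_pmull. Qed.

(** The left side collects, in bits, the net, the choice of pairs, the factor [2 ^ (k * H)] and one
    more [n]; the right side is the decay exponent of [(1 - mx / (4 * n)) ^ (d * k)]. Half of the
    latter absorbs [par_k * par_H] by the choice of [par_H], the other half the rest by the choice
    of [par_k]. *)
Lemma matching_exponent :
  (4 * n * (par_a * n + 2 * (par_k * lg) + par_k * par_H + lg)
    <= par_mx * d * par_k)%N.
Proof.
have h1 : (160 * A * (par_a * n + 2 * (par_k * lg) + lg) <= d * par_k)%N.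
  apply: (@leq_trans (D * par_k)); last by rewrite leq_mul2r D_le_d orbT.
  rewrite -(leq_pmul2l (isT : (0 < 2)%N)).
  have e1 : (2 * (160 * A * (par_a * n + 2 * (par_k * lg) + lg)) =
    320 * A * (par_a * n + lg) + 640 * A * lg * par_k)%N by ring.
  have e2 : (2 * (D * par_k) = par_k * D + D * par_k)%N by ring.
  rewrite e1 e2; apply: leq_add.
    apply: leq_trans k_ge.
    have -> : (A ^ 3 * n = A * (A * (A * n)))%N by ring.
    have -> : (320 * A * (par_a * n + lg) = A * (320 * (par_a * n + lg)))%N by ring.
    rewrite leq_mul2l; apply/orP; right.
    apply: (@leq_trans (320 * (A * n))).
      rewrite leq_mul2l; apply/orP; right.
      apply: (@leq_trans (4 * par_a * n)); last by rewrite leq_mul2r a_le_A orbT.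
      have : (par_a <= par_a * n)%N by rewrite leq_pmulr // (leq_trans _ n2).
      have := lg_le_a; rewrite -mulnA; clear; set y := (par_a * n)%N; lia.
    by rewrite leq_mul2r; apply/orP; right; have := A_ge; clear; lia.
  rewrite leq_mul2r; apply/orP; right.
  apply: leq_trans (@D_ge 2 _) => //.
  have h : (2000 * lg <= A)%N.
    by apply: leq_trans A_lg; rewrite leq_mul2l lg_sq.
  have -> : (640 * A * lg = A * (640 * lg))%N by ring.
  have -> : (324 * A ^ 2 = A * (324 * A))%N by ring.
  by rewrite leq_mul2l; apply/orP; right; move: h; clear; lia.
have A20 : (0 < 20 * A)%N by rewrite muln_gt0 A_gt0.
rewrite -(leq_pmul2l (isT : (0 < 2)%N)).
have h2 : (8 * n * (par_a * n + 2 * (par_k * lg) + lg) <= par_mx * d * par_k)%N.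
  rewrite -(leq_pmul2l A20).
  have -> : (20 * A * (8 * n * (par_a * n + 2 * (par_k * lg) + lg)) =
    n * (160 * A * (par_a * n + 2 * (par_k * lg) + lg)))%N by ring.
  apply: (@leq_trans (n * (d * par_k))); first by rewrite leq_mul2l h1 orbT.
  have -> : (20 * A * (par_mx * d * par_k) = par_mx * (20 * A) * (d * par_k))%N.
    by ring.
  by rewrite leq_mul2r n_le_mx orbT.
have h3 : (8 * n * (par_k * par_H) <= par_mx * d * par_k)%N.
  have : (par_H * (8 * n) <= d * par_mx)%N by exact: leq_trunc_div.
  move=> h.
  have -> : (8 * n * (par_k * par_H) = par_H * (8 * n) * par_k)%N by ring.
  by rewrite leq_mul2r [(par_mx * d)%N]mulnC h orbT.
have -> : (2 * (4 * n * (par_a * n + 2 * (par_k * lg) + par_k * par_H + lg)) =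
  8 * n * (par_a * n + 2 * (par_k * lg) + lg) + 8 * n * (par_k * par_H))%N by ring.
have -> : (2 * (par_mx * d * par_k) = par_mx * d * par_k + par_mx * d * par_k)%N.
  by ring.
exact: leq_add.
Qed.

(** Through [bin_center_sq], this bounds the Littlewood-Offord probability by [A / sqrt D]. *)
Lemma p_ge : (D <= (2 * par_p + 1) * A ^ 2)%N.
Proof.
have h1 : (par_H < par_p.+1 * 4)%N by rewrite ltn_ceil.
have h2 : (d * par_mx < par_H.+1 * (8 * n))%N.
  by rewrite ltn_ceil // muln_gt0 (leq_trans _ n2).
have h3 : (par_H.+1 <= (2 * par_p + 1) * 4)%N by move: h1; clear; lia.
have h4 : (d * par_mx <= (2 * par_p + 1) * 4 * (8 * n))%N.
  by apply: leq_trans (ltnW h2) _; rewrite leq_mul2r h3 orbT.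
have h5 : (d <= (2 * par_p + 1) * (640 * A))%N.
  rewrite -(leq_pmul2r mx_gt0); apply: leq_trans h4 _.
  have -> : ((2 * par_p + 1) * (640 * A) * par_mx =
    (2 * par_p + 1) * 32 * (par_mx * (20 * A)))%N by ring.
  have -> : ((2 * par_p + 1) * 4 * (8 * n) = (2 * par_p + 1) * 32 * n)%N by ring.
  by rewrite leq_mul2l n_le_mx orbT.
apply: leq_trans D_le_d _; apply: leq_trans h5 _.
rewrite leq_mul2l; apply/orP; right; rewrite -mulnn leq_mul2r.
by apply/orP; right; have := A_ge; clear; lia.
Qed.

End ChosenSizes.

(** * Numerical evaluation of the bound *)

Section Estimate.
Variables (R : realType) (n d lg A : nat).
Local Notation D := (minn d n).
Hypotheses (n2 : (2 <= n)%N) (lg0 : (0 < lg)%N) (nlg : (n <= 2 ^ lg)%N).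
Hypotheses (A_lg : (2000 * lg ^ 2 <= A)%N) (hD : (324 * A ^ 4 <= D)%N).
Local Notation q := (par_q n d A).
Local Notation K := (par_K n d A).
Local Notation mx := (par_mx n A).
Local Notation k := (par_k n d A).
Local Notation H := (par_H n d A).
Local Notation p := (par_p n d A).
Local Notation N := (par_N n d A).
Local Notation a := (par_a lg).

Lemma n_gt0R : 0 < n%:R :> R.
Proof. by rewrite ltr0n (leq_trans _ n2). Qed.

Lemma halfX_le s : (2^-1 : R) ^+ (lg * s) <= n%:R^-1 ^+ s.
Proof.
rewrite exprM; apply: lerXn2r; rewrite ?nnegrE ?exprn_ge0 ?invr_ge0 //.
rewrite exprVn lef_pV2 ?posrE ?exprn_gt0 ?n_gt0R //.
by rewrite -natrX ler_nat.
Qed.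

Lemma structured_term m : (m < mx)%N ->
  ((n * (2 * N).+1 ^ 2) ^ m * (2 * N).+1 ^ 2)%:R *
      (3 / 4) ^+ minn (d * (m %/ q).+1) (n %/ 10) <= (2^-1 : R) ^+ (lg * 3).
Proof.
move=> mmx; have hT := T_ge lg0 A_lg hD mmx.
set T := minn _ _ in hT *.
have hg := grid_le n2 lg0 nlg A_lg hD.
have h1 : ((n * (2 * N).+1 ^ 2) ^ m * (2 * N).+1 ^ 2 <= 2 ^ (a * m.+1))%N.
  rewrite mulnS expnD mulnC leq_mul //.
    by apply: leq_trans hg; rewrite leq_pmulr // (leq_trans _ n2).
  case: m {mmx hT T} => [|m]; first by rewrite muln0.
  by rewrite expnM leq_exp2r // mulnC.
(* The factor [3] is used through [(3/4) ^ 3 <= 1/2]; the surplus [lg * 3] leaves [n ^ -3] after the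
   net is paid for. *)
have h2 : (3 * (a * m.+1 + lg * 3) <= T)%N.
  apply: leq_trans hT; apply: (@leq_trans (2000 * lg ^ 2 * m.+1)); last first.
    by rewrite leq_mul2r A_lg orbT.
  have := lg_sq lg0; rewrite /par_a; set y := (lg ^ 2)%N => ly.
  have : (lg <= y * m.+1)%N by apply: leq_trans ly _; rewrite leq_pmulr.
  rewrite -!mulnA; move: (y * m.+1)%N => x; clear; lia.
have h3 : (3 / 4 : R) ^+ T <= 2^-1 ^+ (a * m.+1 + lg * 3).
  apply: (@le_trans _ _ ((3 / 4) ^+ (3 * (a * m.+1 + lg * 3)))).
    by apply: ler_wiXn2l; [lra|lra|].
  rewrite exprM; apply: lerXn2r; rewrite ?nnegrE ?exprn_ge0 //; try lra.
apply: (@le_trans _ _ (2 ^+ (a * m.+1) * 2^-1 ^+ (a * m.+1 + lg * 3))).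
  apply: ler_pM => //; first by rewrite exprn_ge0 //; lra.
  by rewrite -natrX ler_nat.
rewrite exprD mulrA -exprMn mulfV ?pnatr_eq0 // expr1n mul1r //.
Qed.

Lemma structured_total : (K * mx)%:R * (2^-1 : R) ^+ (lg * 3) <= n%:R^-1.
Proof.
have nR := n_gt0R.
have h1 : (K * mx <= n ^ 2)%N.
  rewrite -mulnn; apply: leq_mul.
    have := K_le_lg lg0 nlg A_lg hD; move=> h.
    apply: leq_trans (up_log_min _ (ltnW (ltn_expl n (isT : (1 < 2)%N)))) => //.
    apply: up_log_min; first exact: (q_gt1 lg0 A_lg hD).
    apply: leq_trans (up_logP n (isT : (1 < 2)%N)) _.
    case: (up_log 2 n) => [|e]; first by rewrite !expn0.
    by rewrite leq_exp2r // (q_gt1 lg0 A_lg hD).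
  have := mx2_le n lg0 A_lg; clear; lia.
apply: (@le_trans _ _ (n%:R ^+ 2 * n%:R^-1 ^+ 3)).
  by apply: ler_pM; rewrite ?exprn_ge0 ?invr_ge0 ?halfX_le // -natrX ler_nat.
by rewrite [_^-1 ^+ 3]exprSr mulrA -exprMn mulfV ?gt_eqF // expr1n mul1r.
Qed.

Lemma two_le_expR1 : 2 <= sequences.expR 1 :> R.
Proof. by have := expR_ge1Dx (1 : R); lra. Qed.

Lemma exp2_le_expR s : 2 ^+ s <= sequences.expR s%:R :> R.
Proof.
rewrite -[s%:R]mul1r expRM_natr.
by apply: lerXn2r; rewrite ?nnegrE ?expR_ge0 ?two_le_expR1.
Qed.

Lemma matching_total :
  (((2 * N).+1 ^ 2) ^ n * n ^ k * n ^ k)%:R *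
     (2 ^+ (k * H) * (1 - mx%:R / (4 * n%:R)) ^+ (d * k)) <= n%:R^-1 :> R.
Proof.
have nR := n_gt0R.
have h1 : (((2 * N).+1 ^ 2) ^ n * n ^ k * n ^ k <= 2 ^ (a * n + 2 * (k * lg)))%N.
  rewrite expnD -mulnA leq_mul //.
    rewrite expnM leq_exp2r ?(leq_trans _ n2) //.
    apply: leq_trans (grid_le n2 lg0 nlg A_lg hD).
    by rewrite leq_pmulr // (leq_trans _ n2).
  rewrite mul2n -addnn expnD [(k * lg)%N]mulnC expnM.
  by apply: leq_mul; rewrite leq_exp2r.
set x : R := mx%:R / (4 * n%:R).
have x1 : 0 <= 1 - x.
  rewrite subr_ge0 ler_pdivrMr ?mul1r ?mulr_gt0 // -natrM ler_nat.
  have := mx2_le n lg0 A_lg; clear; lia.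
have h2 : (1 - x) ^+ (d * k) <= sequences.expR (- (x * (d * k)%:R)).
  have -> : - (x * (d * k)%:R) = (d * k)%:R * (- x) by rewrite mulrN mulrC.
  rewrite mulrC expRM_natr; apply: lerXn2r; rewrite ?nnegrE ?expR_ge0 //.
  exact: expR_ge1Dx.
have h3 : (((2 * N).+1 ^ 2) ^ n * n ^ k * n ^ k)%:R * 2 ^+ (k * H) <=
    sequences.expR (a * n + 2 * (k * lg) + k * H)%:R :> R.
  apply: le_trans (exp2_le_expR _); rewrite exprD ler_pM2r ?exprn_gt0 //.
  by rewrite -natrX ler_nat.
rewrite mulrA; apply: le_trans (ler_pM _ _ h3 h2) _.
- by rewrite mulr_ge0 ?exprn_ge0.
- exact: exprn_ge0.
rewrite -expRD.
apply: (@le_trans _ _ (sequences.expR (- lg%:R))); last first.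
  rewrite expRN lef_pV2 ?posrE ?expR_gt0 //.
  apply: le_trans (exp2_le_expR _); by rewrite -natrX ler_nat.
rewrite ler_expR.
have := matching_exponent n2 lg0 A_lg hD.
rewrite -(ler_nat R) 2!natrM [X in _ <= X]natrM [(mx * d)%:R]natrM [(_ + lg)%:R]natrD.
rewrite -mulrA [(d * k)%:R]natrM.
set s := (a * n + _ + _)%:R => h.
have -> : x * (d%:R * k%:R) = (mx%:R * d%:R * k%:R) / (4 * n%:R) :> R.
  by rewrite /x; field; rewrite gt_eqF.
have n4 : 0 < 4 * n%:R :> R by rewrite mulr_gt0.
have : s + lg%:R <= mx%:R * d%:R * k%:R / (4 * n%:R).
  by rewrite ler_pdivlMr // mulrC -[X in X <= _]mulrA.
by lra.
Qed.

Lemma D_gt0 : (0 < D)%N.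
Proof. by apply: leq_trans hD; rewrite muln_gt0 expn_gt0 (A_gt0 lg0 A_lg). Qed.

Lemma sqrtD_gt0 : 0 < Num.sqrt (D%:R : R).
Proof. by rewrite sqrtr_gt0 ltr0n D_gt0. Qed.

Lemma pair_total :
  n%:R * ('C(2 * p, p)%:R / 4 ^+ p) / (mx - 4 * k)%:R
    <= 40 * A%:R ^+ 2 / Num.sqrt (D%:R : R).
Proof.
have A0 : 0 < A%:R :> R by rewrite ltr0n (A_gt0 lg0 A_lg).
have kmx := k_le_mx lg0 A_lg hD; have mx0 := mx_gt0 lg0 A_lg hD.
have m0 : 0 < (mx - 4 * k)%:R :> R.
  rewrite ltr0n subn_gt0; apply: leq_trans kmx.
  by rewrite ltn_mul2r.
have h1 : n%:R <= 40 * A%:R * (mx - 4 * k)%:R :> R.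
  rewrite -!natrM ler_nat; apply: leq_trans (n_le_mx lg0 A_lg hD) _.
  have h : (mx <= 2 * (mx - 4 * k))%N.
    by move: kmx; move: k mx => x y; clear; lia.
  apply: (@leq_trans (2 * (mx - 4 * k) * (20 * A))).
    by rewrite leq_mul2r h orbT.
  by rewrite leq_eqVlt; apply/orP; left; apply/eqP; ring.
have s0 := sqrtD_gt0.
have h2 : 'C(2 * p, p)%:R / 4 ^+ p <= A%:R / Num.sqrt (D%:R : R).
  rewrite ler_pdivlMr // mulrAC ler_pdivrMr ?exprn_gt0 //.
  have lhs0 : 0 <= 'C(2 * p, p)%:R * Num.sqrt (D%:R : R) by rewrite mulr_ge0 // ltW.
  have rhs0 : 0 <= A%:R * 4 ^+ p :> R by rewrite mulr_ge0 ?exprn_ge0.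
  rewrite -(ler_pXn2r (isT : (0 < 2)%N)) ?nnegrE //.
  rewrite !exprMn sqr_sqrtr // -exprM -!natrX -!natrM ler_nat.
  have b := bin_center_sq p; have pg := p_ge n2 lg0 A_lg hD.
  apply: (@leq_trans ('C(2 * p, p) ^ 2 * ((2 * p + 1) * A ^ 2))).
    by rewrite leq_mul2l pg orbT.
  rewrite mulnA mulnC leq_mul2l; apply/orP; right.
  by rewrite [(p * 2)%N]mulnC expnM.
rewrite ler_pdivrMr //.
apply: (@le_trans _ _ (40 * A%:R * (mx - 4 * k)%:R * (A%:R / Num.sqrt D%:R))).
  by apply: ler_pM => //; rewrite divr_ge0 ?exprn_ge0.
by rewrite le_eqVlt; apply/orP; left; apply/eqP; ring.
Qed.

Lemma inv_n_le : n%:R^-1 <= A%:R ^+ 2 / Num.sqrt (D%:R : R).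
Proof.
have nR := n_gt0R; have s0 := sqrtD_gt0.
rewrite ler_pdivlMr // mulrC ler_pdivrMr //.
apply: (@le_trans _ _ D%:R).
  rewrite -{2}(@sqr_sqrtr _ (D%:R : R)) // expr2.
  apply: ler_peMl; first exact: ltW.
  by rewrite -[X in X <= _]sqrtr1 ler_wsqrtr // ler1n D_gt0.
apply: (@le_trans _ _ n%:R); first by rewrite ler_nat D_le_n.
by rewrite ler_peMl // ?exprn_ege1 // ler1n (A_gt0 lg0 A_lg).
Qed.

Variables (z : R[i]) (t : R).
Let rd : R := Num.sqrt d%:R.
Let w : R[i] := rd%:C * z.
Hypotheses (dn : (d <= n ^ 100)%N) (wd : cabs w <= d%:R / 2) (t0 : 0 < t).
Hypothesis t_small : t <= n%:R^-1 ^+ (220 * K.+1 + 61).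

Lemma uprob_smin_le :
  uprob R (fun pi : perms n d => smin (shifted_matrix z pi) <= t)
    <= 43 * A%:R ^+ 2 / Num.sqrt (D%:R : R).
Proof.
have d0 : (0 < d)%N by apply: leq_trans D_gt0 (D_le_d _ _).
have n0 : (0 < n)%N by apply: leq_trans n2.
have nR := n_gt0R.
have n1R : 1 <= n%:R :> R by rewrite ler1n.
set tau := rd * (2 * n%:R ^+ 2 * t).
(* [P] must dominate [16 * d], and [d <= n ^ 100], [16 <= n ^ 10]. *)
pose P : R := n%:R ^+ 110.
have rd0 : 0 < rd by rewrite sqrtr_gt0 ltr0n.
have rd1 : rd <= n%:R ^+ 50.
  rewrite -[X in _ <= X]ger0_norm ?exprn_ge0 // -sqrtr_sqr ler_wsqrtr //.
  by rewrite -exprM -natrX ler_nat.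
have tau0 : 0 <= tau by rewrite !mulr_ge0 ?exprn_ge0 // ltW.
have sc : scale P K * scale P K = n%:R^-1 ^+ (220 * K.+1).
  by rewrite /scale /P -exprVn -exprM -exprD; congr (_ ^+ _); clear; lia.
have P16 : 16 * d%:R <= P.
  rewrite /P -natrM -natrX ler_nat (_ : 110 = 10 + 100)%N // expnD.
  apply: leq_mul => //; apply: (@leq_trans (2 ^ 10)) => //.
  by rewrite leq_exp2r.
have s0 : 0 < scale P K by apply: (scale_gt0 (d := d)).
have s1 : scale P K <= 1.
  rewrite /scale exprn_ile1 // ?invr_ge0 ?exprn_ge0 //.
  by rewrite invf_le1 ?exprn_gt0 // exprn_ege1.
have tau_small : 4 * ((2 * n + 2)%:R * tau) < scale P K / 4 * scale P K.
  rewrite mulrAC sc.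
  have h1 : tau <= n%:R ^+ 50 * (2 * n%:R ^+ 2 * n%:R^-1 ^+ (220 * K.+1 + 61)).
    apply: ler_pM => //; first by rewrite ltW.
      by rewrite !mulr_ge0 ?exprn_ge0 // ltW.
    by rewrite ler_wpM2l // mulr_ge0 ?exprn_ge0.
  (* Here [61 = 50 + 2 + 9]: [sqrt d <= n ^ 50], then the [n ^ 2] of [near_null_vectors], and
     [n ^ 9] to spare for the factor [2 * n + 2] and the constants. *)
  have n9 : n%:R ^+ 50 * (2 * n%:R ^+ 2 * n%:R^-1 ^+ (220 * K.+1 + 61)) =
      2 * n%:R^-1 ^+ 9 * n%:R^-1 ^+ (220 * K.+1) :> R.
    rewrite exprD; set e := _ ^+ (220 * _).
    have -> : n%:R^-1 ^+ 61 = n%:R^-1 ^+ 52 * n%:R^-1 ^+ 9 :> R by rewrite -exprD.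
    have c52 : n%:R ^+ 50 * n%:R ^+ 2 * n%:R^-1 ^+ 52 = 1 :> R.
      by rewrite -exprD -exprMn mulfV ?gt_eqF // expr1n.
    transitivity ((n%:R ^+ 50 * n%:R ^+ 2 * n%:R^-1 ^+ 52) *
      (2 * n%:R^-1 ^+ 9 * e)); first by ring.
    by rewrite c52 mul1r.
  set e := n%:R^-1 ^+ (220 * K.+1) in n9 *.
  have e0 : 0 < e by rewrite exprn_gt0 // invr_gt0.
  apply: (@le_lt_trans _ _ (4 * ((2 * n + 2)%:R * (2 * n%:R^-1 ^+ 9 * e)))).
    by rewrite -n9 ler_pM2l // ler_wpM2l.
  have -> : 4 * ((2 * n + 2)%:R * (2 * n%:R^-1 ^+ 9 * e)) =
     (16 * (n + 1)%:R * n%:R^-1 ^+ 9) * e.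
    have -> : (2 * n + 2)%:R = 2 * (n + 1)%:R :> R.
      by rewrite -natrM; congr (_%:R); clear; lia.
    by ring.
  rewrite [e / 4]mulrC ltr_pM2r // exprVn ltr_pdivrMr ?exprn_gt0 //.
  rewrite ltr_pdivlMl // -natrX -!natrM ltr_nat.
  have -> : (n ^ 9 = n ^ 6 * (n * n * n))%N by ring.
  have h6 : (64 <= n ^ 6)%N by apply: (@leq_trans (2 ^ 6)); rewrite ?leq_exp2r.
  have h7 : (n + 1 < n * n * n)%N by move: n2; clear; nia.
  apply: (@leq_trans (64 * (n * n * n))); last by rewrite leq_mul2r h6 orbT.
  by move: h7; clear; move: (n * n * n)%N => y; lia.
have tauK : tau <= d%:R * scale P K.
  have d1 : 1 <= d%:R :> R by rewrite ler1n.
  have h1 : scale P K <= d%:R * scale P K by rewrite ler_peMl // ltW.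
  apply: le_trans h1.
  have h2 : tau <= 4 * ((2 * n + 2)%:R * tau).
    rewrite mulrA ler_peMl // -natrM ler1n; move: n0; clear; lia.
  have h3 : scale P K / 4 * scale P K <= scale P K.
    by apply: ler_piMl; [exact: ltW|lra].
  by apply: le_trans h2 _; apply: le_trans (ltW tau_small) h3.
apply: (@le_trans _ _ (uprob R (fun pi => rnull w tau pi /\ lnull w tau pi))).
  by apply: uprob_le => pi; apply: smin_near_null.
have NK : 2 / (N%:R : R) <= scale P K / 8.
  rewrite /par_N natrM natrX /scale exprVn invfM /P natrX le_eqVlt; apply/orP; left.
  by apply/eqP; field; rewrite !expf_neq0 ?gt_eqF.
have N0 : (0 < N)%N by rewrite muln_gt0 !expn_gt0 n0.
have q0 : (0 < q)%N by apply: ltnW; apply: (q_gt1 lg0 A_lg hD).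
have kmx : (4 * k < mx)%N.
  by apply: leq_trans (k_le_mx lg0 A_lg hD); rewrite ltn_mul2r.
have pH : (4 * p <= H)%N by rewrite mulnC leq_trunc_div.
have := uprob_near_null d0 n0 P16 q0 (n_le_qK lg0 A_lg hD) (mx2_le n lg0 A_lg) wd
   tau0 tauK N0 NK structured_term kmx tau_small pH.
move/le_trans; apply.
(* The constant is [43 = 2 + 1 + 40]: three terms at most [n^-1], each absorbed by [inv_n_le], and
   the pair term. *)
have b1 := structured_total; have b2 := matching_total; have b3 := pair_total.
have b4 := inv_n_le.
move: b1 b2 b3 b4; rewrite -![_ * _ ^+ 2 / _]mulrA.
set y := A%:R ^+ 2 / _.
move: (_ * _ ^+ (lg * 3)) (_ * (2 ^+ _ * _)) (_ * _ / (mx - _)%:R) (n%:R^-1).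
by move=> y1 y2 y3 y4; lra.
Qed.

End Estimate.

Lemma ln2_ge_half (R : realType) : 2^-1 <= ln (2 : R).
Proof.
have := @le_ln1Dx R (- 2^-1); rewrite (_ : 1 + - 2^-1 = 2^-1); last by lra.
by rewrite lnV ?posrE // => /(_ ltac:(lra)); lra.
Qed.

(** * Comparison of integer and natural logarithms *)

Section Logarithms.
Variables (R : realType) (n : nat).
Hypothesis n2 : (2 <= n)%N.
Local Notation L := (ln (n%:R : R)).

Lemma ln_n_ge : 2^-1 <= L.
Proof.
apply: le_trans (ln2_ge_half R) _.
by rewrite ler_ln ?posrE ?ltr0n ?(leq_trans _ n2) // ler_nat.
Qed.

Lemma up_log_le_ln : (up_log 2 n)%:R <= 4 * L.
Proof.
have n1 : (1 < n)%N by [].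
have lg0 : (0 < up_log 2 n)%N by rewrite up_log_gt0.
have := up_log_gtn (isT : (1 < 2)%N) n1; set lg := up_log 2 n in lg0 *.
move=> h.
have h1 : (lg.-1)%:R * ln (2 : R) <= L.
  rewrite mulr_natl -lnXn //.
  by rewrite ler_ln ?posrE ?exprn_gt0 ?ltr0n ?(leq_trans _ n2) // -natrX ler_nat ltnW.
have h2 : lg%:R = lg.-1%:R + 1 :> R by rewrite natr1 prednK.
have h3 := ln2_ge_half R; have h4 := ln_n_ge.
have h5 : lg.-1%:R * 2^-1 <= lg.-1%:R * ln (2 : R) by rewrite ler_wpM2l.
lra.
Qed.

(** From [q ^ K.-1 < n] and [D <= q ^ 2], [K - 1] is at most [2 * L / ln D]; the remaining [1] is at
    most [L / ln D] because [D <= n]. *)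
Lemma par_K_le (d lg A : nat) : (0 < lg)%N -> (2000 * lg ^ 2 <= A)%N ->
  (324 * A ^ 4 <= minn d n)%N ->
  0 < ln ((minn d n)%:R : R) <= L /\
  (par_K n d A)%:R <= 3 * (L / ln ((minn d n)%:R : R)).
Proof.
move=> lg0 hA hD; set D := minn d n in hD *; set K := par_K n d A.
have q1 := q_gt1 lg0 hA hD; have Dq := D_le_q2 lg0 hA hD.
have D1 : (1 < D)%N.
  apply: leq_trans hD; rewrite (leq_trans (isT : (1 < 324)%N)) // leq_pmulr //.
  by rewrite expn_gt0 (A_gt0 lg0 hA).
have lnD0 : 0 < ln (D%:R : R) by rewrite ln_gt0 // ltr1n.
have lnDL : ln (D%:R : R) <= L.
  rewrite ler_ln ?posrE ?ltr0n ?ler_nat ?geq_minr //; first exact: ltnW.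
  exact: leq_trans n2.
split; first by rewrite lnD0.
have K0 : (0 < K)%N by rewrite up_log_gt0 q1 (leq_trans _ n2).
have qlt := up_log_gtn q1 (n2 : (1 < n)%N).
rewrite mulrA ler_pdivlMr //.
have h1 : K.-1%:R * ln ((par_q n d A)%:R : R) <= L.
  rewrite mulr_natl -lnXn ?ltr0n ?(ltnW q1) //.
  rewrite ler_ln ?posrE ?exprn_gt0 ?ltr0n ?(ltnW q1) //; last exact: leq_trans n2.
  by rewrite -natrX ler_nat ltnW.
have h2 : ln (D%:R : R) <= 2 * ln ((par_q n d A)%:R : R).
  rewrite mulr_natl -lnXn ?ltr0n ?(ltnW q1) //.
  rewrite ler_ln ?posrE ?exprn_gt0 ?ltr0n ?(ltnW q1) ?(ltnW D1) //.
  by rewrite -natrX ler_nat.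
have h3 : K%:R = K.-1%:R + 1 :> R by rewrite natr1 prednK.
have h4 : K.-1%:R * ln (D%:R : R) <= K.-1%:R * (2 * ln ((par_q n d A)%:R : R)).
  by rewrite ler_wpM2l.
rewrite mulrCA in h4; rewrite h3 mulrDl mul1r.
move: h1 h4; move: (K.-1%:R * _) (K.-1%:R * _) => y1 y2; lra.
Qed.

End Logarithms.

(** * Conclusion: constants and degenerate cases *)

Theorem theorem2p1 (R : realType) :
  exists Cbar : R, 0 < Cbar /\
  forall Rad : R, 0 < Rad ->
  exists C : R,
  forall (n d : nat) (z : R[i]),
    (2 <= n)%N -> (1 <= d)%N -> (d <= n ^ 100)%N ->
    `|z| <= Rad%:C ->
    uprob R (fun pi : {ffun 'I_d -> {perm 'I_n}} =>
        smin (shifted_matrix z pi) <=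
        (n%:R : R) `^ (- (Cbar * (ln (n%:R : R) / ln ((minn d n)%:R : R))))) <=
      C * (ln (n%:R : R)) ^+ 4 / Num.sqrt ((minn d n)%:R : R).
Proof.
(* With [Y = L / ln D >= 1] and [K <= 3 * Y], the required exponent [220 * (K + 1) + 61] is at most
   [941 * Y]. *)
exists 1000; split => // Rad Rad0.
(* For [A = 2000 * lg ^ 2] and [lg <= 4 * L], [A ^ 2] is at most [2000 ^ 2 * 4 ^ 4 * L ^ 4]; the
   name is kept opaque to prevent computation. *)
have [B eB] : exists B : R, B = 2000 ^+ 2 * 256 by eexists.
exists (43 * B + 32 * Rad) => n d z n2 d1 dn zR.
set L := ln n%:R; set D := minn d n; set sD := Num.sqrt _; set E := fun _ => _.
have D1 : (0 < D)%N by rewrite leq_min d1 (leq_trans _ n2).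
have sD0 : 0 < sD by rewrite sqrtr_gt0 ltr0n.
have L2 : 2^-1 <= L := ln_n_ge R n2.
have B0 : 0 <= B by rewrite eB mulr_ge0 // exprn_ge0.
have L4 : 1 <= 16 * L ^+ 4.
  have h : 2^-1 ^+ 4 <= L ^+ 4.
    by apply: lerXn2r; rewrite ?nnegrE ?invr_ge0 // (le_trans _ L2) ?invr_ge0.
  have e : (2^-1 : R) ^+ 4 = 16^-1 by rewrite exprVn -natrX.
  by rewrite e in h; rewrite -ler_pdivrMl // mulr1.
have L0 : 0 <= L by rewrite (le_trans _ L2) ?invr_ge0.
have L40 : 0 <= L ^+ 4 by rewrite exprn_ge0.
set lg := up_log 2 n.
have lg0 : (0 < lg)%N by rewrite up_log_gt0.
have nlg : (n <= 2 ^ lg)%N := up_logP n (isT : (1 < 2)%N).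
have [A hA AB] : exists2 A, (2000 * lg ^ 2 <= A)%N & A%:R ^+ 2 <= B * L ^+ 4.
  exists (2000 * lg ^ 2)%N => //.
  have h : lg%:R ^+ 4 <= (4 * L) ^+ 4.
    by apply: lerXn2r; rewrite ?nnegrE ?up_log_le_ln // mulr_ge0.
  rewrite natrM natrX exprMn -exprM eB -mulrA ler_wpM2l ?exprn_ge0 //.
  have e : 4 ^+ 4 = 256 :> R by rewrite -natrX.
  by move: h; rewrite exprMn e.
have trivial_case : sD <= (43 * B + 32 * Rad) * L ^+ 4 ->
    uprob R E <= (43 * B + 32 * Rad) * L ^+ 4 / sD.
  by move=> h; apply: le_trans (uprob_le1 _ _) _; rewrite ler_pdivlMr // mul1r.
have BL0 : 0 <= B * L ^+ 4 by rewrite mulr_ge0.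
have RL : 2 * Rad <= 32 * Rad * L ^+ 4.
  have -> : 32 * Rad * L ^+ 4 = 2 * Rad * (16 * L ^+ 4) by ring.
  by rewrite ler_peMr // mulr_ge0 // ltW.
have Rad2 : 0 <= 2 * Rad by rewrite mulr_ge0 // ltW.
(* If [d < (2 * Rad) ^ 2], the term [32 * Rad] makes the claimed bound at least [1]; otherwise
   [2 * Rad <= sqrt d], which yields the bound [d / 2] on the modulus of [w]. *)
have [dR|dR] := ltrP (d%:R : R) ((2 * Rad) ^+ 2).
  apply: trivial_case.
  have : sD <= 2 * Rad.
    rewrite -[X in _ <= X]ger0_norm // -sqrtr_sqr ler_wsqrtr //.
    by apply: le_trans (ltW dR); rewrite ler_nat geq_minl.
  move/le_trans; apply; rewrite [X in _ <= X]mulrDl; apply: le_trans RL _.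
  by rewrite lerDr -mulrA mulr_ge0.
(* If [D < 324 * A ^ 4] then [sqrt D <= 18 * A ^ 2], and the claimed bound again exceeds [1]. *)
have [hD|hD] := leqP (324 * A ^ 4) D; last first.
  apply: trivial_case.
  have : sD <= 18 * A%:R ^+ 2.
    rewrite -[X in _ <= X]ger0_norm; last by rewrite mulr_ge0 ?exprn_ge0.
    rewrite -sqrtr_sqr ler_wsqrtr // exprMn -exprM -!natrX -natrM ler_nat.
    exact: ltnW.
  move/le_trans; apply; rewrite [X in _ <= X]mulrDl -[43 * B * _]mulrA.
  clear -AB BL0 RL Rad2.
  by move: AB BL0 RL Rad2; move: (A%:R ^+ 2) (B * _) (32 * _ * _) => y1 y2 y3; lra.
have [/andP[lnD0 lnDL] Kle] := par_K_le R n2 lg0 hA hD.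
rewrite -/L -/D in lnD0 lnDL Kle.
have t0 : 0 < (n%:R : R) `^ (- (1000 * (L / ln D%:R))).
  by rewrite powR_gt0 // ltr0n (leq_trans _ n2).
have Y1 : 1 <= L / ln D%:R by rewrite ler_pdivlMr // mul1r.
have tsm : (n%:R : R) `^ (- (1000 * (L / ln D%:R))) <=
    n%:R^-1 ^+ (220 * (par_K n d A).+1 + 61).
  rewrite exprVn -powR_mulrn // -powRN; apply: ler_powR.
    by rewrite ler1n (leq_trans _ n2).
  rewrite lerN2 natrD natrM -[(par_K n d A).+1%:R]natr1.
  clear -Kle Y1; move: Kle Y1; move: (L / _) ((par_K n d A)%:R : R) => Y k; lra.
have wd : cabs ((Num.sqrt d%:R)%:C * z) <= d%:R / 2.
  rewrite cabsM cabsR ger0_norm ?sqrtr_ge0 //.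
  have zR' : cabs z <= Rad by rewrite -lecR -cabsE.
  have h : 2 * Rad <= Num.sqrt d%:R.
    by rewrite -[X in X <= _]ger0_norm // -sqrtr_sqr ler_wsqrtr.
  have h2 : Num.sqrt d%:R * cabs z <= Num.sqrt d%:R * (Num.sqrt d%:R / 2).
    rewrite ler_wpM2l ?sqrtr_ge0 // ler_pdivlMr // mulrC.
    by apply: le_trans h; rewrite ler_wpM2l.
  by apply: le_trans h2 _; rewrite mulrA -expr2 sqr_sqrtr.
apply: le_trans (uprob_smin_le n2 lg0 nlg hA hD dn wd t0 tsm) _.
rewrite ler_pM2r ?invr_gt0 // [X in _ <= X]mulrDl -[43 * B * _]mulrA.
clear -AB RL Rad2.
by move: AB RL Rad2; move: (A%:R ^+ 2) (B * _) (32 * _ * _) => y1 y2 y3; lra.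
Qed.
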